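(* Let $p$ be an odd prime, $F$ a field containing a primitive $p$th root of unity, $a\in\dot F\setminus\dot F^p$ and $E=F(\sqrt[p]{a})$. If $F$ is $p$-rigid, then $E$ is $p$-rigid.
   Context: For a field $L$, $\dot L=L\setminus\{0\}$ and $\dot L^p$ is the group of nonzero $p$th powers. An element $b\in\dot L\setminus\dot L^p$ is $p$-rigid if every element of $N_{L(\sqrt[p]{b})/L}(L(\sqrt[p]{b})^\times)$ lies in $\bigcup_{k=0}^{p-1}b^k\dot L^p$; $L$ is $p$-rigid if every element of $\dot L\setminus\dot L^p$ is $p$-rigid. *)

(* Defs.v *)
From HB Require Import structures.
From mathcomp Require Import all_boot all_order all_algebra all_field.
Set Implicit Arguments. Unset Strict Implicit. Unset Printing Implicit Defensive.
Import GRing.Theory.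
Local Open Scope ring_scope.

Definition is_nz_pth_power (L : fieldType) (p : nat) (x : L) : Prop :=
  exists2 y : L, y != 0 & x = y ^+ p.

Definition fieldNorm (L : fieldType) (K : fieldExtType L) (y : K) : L :=
  \det (passmx.mxof (vbasis {:K}) (vbasis {:K}) (amulr y)).

Definition p_rigid_elt (L : fieldType) (p : nat) (b : L) : Prop :=
  forall (K : fieldExtType L) (beta : K),
    beta ^+ p = b%:A -> <<1; beta>>%VS = fullv ->
    forall y : K, y != 0 ->
      exists2 k : nat, (k < p)%N &
        exists2 z : L, is_nz_pth_power p z & fieldNorm y = b ^+ k * z.

Definition p_rigid (L : fieldType) (p : nat) : Prop :=
  forall b : L, b != 0 -> ~ is_nz_pth_power p b -> p_rigid_elt p b.

(* Main.v *)
Require Import Defs.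
From HB Require Import structures.
From mathcomp Require Import all_boot all_order all_algebra all_field.
From mathcomp Require Import ring.
From Stdlib Require Import Classical.
Set Implicit Arguments. Unset Strict Implicit. Unset Printing Implicit Defensive.
Import GRing.Theory.
Local Open Scope ring_scope.

(**
Write <S> for the subgroup generated by S and the pth powers. Hilbert 90, the rigidity of F and (s - 1)^p = 0 in F_p[Gal(E/F)] show that the nonzero elements of E are the alpha^k g e^p with g in F.

Let n be a norm from E(b^(1/p)). If b = alpha^k g e^p with p not dividing k, then multiplying n by a power of b reduces to n = m in F. If m is not in <b>, symmetry of the norm relation (again Hilbert 90) makes b a norm from E(m^(1/p)); taking norms to F gives a^k in <m>, hence a in <m> and m is a pth power in E, a contradiction.

Otherwise b = f in F, and taking norms to F gives n = m in F modulo pth powers. The field M = E(f^(1/p)) has group Z/p x Z/p over F. If N_{M/E}(u) = m, then up to pth powers the norm of u to each of the p + 1 intermediate fields is m times an element of <zeta, a, f>, while the product of these norms is u^p N_{M/F}(u) = u^p m^p. Hence m^(p+1) and so m lies in <zeta, a, f>. If m were not in <a, f>, then zeta would be a norm from M to E and zeta would not be in <a, f>. By symmetry f would be a norm from E(zeta^(1/p)), and the same result with zeta in place of f would put f in <zeta, a>, a contradiction. *)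

(** * Subgroups modulo pth powers *)

(** Natural exponents give a group, since the inverse of [c] is [c ^+ p.-1] times a pth power. The
    list [[:: b]] gives the set in the definition of rigidity. *)
Fixpoint pspan (L : fieldType) (p : nat) (s : seq L) (x : L) : Prop :=
  if s is c :: s' then exists k : nat, exists2 y, pspan p s' y & x = c ^+ k * y
  else is_nz_pth_power p x.

Section PSpan.
Variables (L : fieldType) (p : nat).
Implicit Types (s : seq L) (x y z c : L).

Lemma pspan_neq0 s x : 0 \notin s -> pspan p s x -> x != 0.
Proof.
elim: s x => [|c s IHs] x /=; first by move=> _ [z z0 ->]; rewrite expf_neq0.
rewrite inE negb_or eq_sym => /andP[c0 s0] [k [y /IHs-/(_ s0) y0 ->]].
by rewrite mulf_neq0 ?expf_neq0.
Qed.

Lemma pspan_pow s z : z != 0 -> pspan p s (z ^+ p).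
Proof.
move=> z0; elim: s => [|c s IHs] /=; first by exists z.
by exists 0; exists (z ^+ p); rewrite ?mul1r.
Qed.

Lemma pspan1 s : pspan p s 1.
Proof. by rewrite -(expr1n _ p); apply: pspan_pow; apply: oner_neq0. Qed.

Lemma pspanM s x y : pspan p s x -> pspan p s y -> pspan p s (x * y).
Proof.
elim: s x y => [|c s IHs] x y /=.
  by move=> [u u0 ->] [v v0 ->]; exists (u * v); rewrite ?mulf_neq0 ?exprMn.
move=> [k [u su ->]] [l [v sv ->]]; exists (k + l)%N, (u * v); first exact: IHs.
by rewrite exprD mulrACA.
Qed.

Lemma pspanX s n x : pspan p s x -> pspan p s (x ^+ n).
Proof.
move=> sx; elim: n => [|n IHn]; first exact: pspan1.
by rewrite exprS; apply: pspanM.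
Qed.

Lemma pspan_mem s c : c \in s -> pspan p s c.
Proof.
elim: s => //= d s IHs; rewrite inE => /predU1P[->|/IHs sc].
  by exists 1, 1; rewrite ?expr1 ?mulr1 //; apply: pspan1.
by exists 0, c; rewrite ?mul1r.
Qed.

Lemma pspan_sub s s' x :
  (forall c, c \in s -> pspan p s' c) -> pspan p s x -> pspan p s' x.
Proof.
elim: s x => [|c s IHs] x sub /=; first by move=> [z z0 ->]; apply: pspan_pow.
move=> [k [y sy ->]]; apply: pspanM.
  by apply/pspanX/sub/mem_head.
by apply: IHs sy => d sd; apply: sub; rewrite inE sd orbT.
Qed.

Hypothesis p_pr : prime p.
Let p_gt0 : (0 < p)%N := prime_gt0 p_pr.

Lemma pspanV s x : x != 0 -> pspan p s x -> pspan p s x^-1.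
Proof.
move=> x0 sx; have -> : x^-1 = x ^+ p.-1 * x^-1 ^+ p.
  by rewrite -[in X in _ * X](prednK p_gt0) exprSr mulrA -exprMn divff // expr1n mul1r.
by apply: pspanM; [apply: pspanX|apply: pspan_pow; rewrite invr_eq0].
Qed.

Lemma pspanMl s x y : x != 0 -> pspan p s x -> pspan p s (x * y) -> pspan p s y.
Proof.
move=> x0 sx sxy; rewrite -[y](mulKf x0); apply: pspanM => //.
exact: pspanV.
Qed.

Lemma bezout_prime n : ~~ (p %| n)%N -> exists u v : nat, (u * n = v * p + 1)%N.
Proof.
move=> pn; have n0 : (0 < n)%N by case: n pn; rewrite ?dvdn0.
have cop : coprime n p by rewrite coprime_sym prime_coprime.
case: (egcdnP p n0) => u v uv _; exists u, v; rewrite uv.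
by move: cop; rewrite /coprime => /eqP ->.
Qed.

(** The group modulo pth powers has exponent [p], so raising to a power prime to [p] is invertible:
    if [u n = v p + 1], then [x] is [(x^n)^u / (x^v)^p]. *)
Lemma pspan_root s n x :
  x != 0 -> ~~ (p %| n)%N -> pspan p s (x ^+ n) -> pspan p s x.
Proof.
move=> x0 /bezout_prime[u [v uv]] sx.
apply: (@pspanMl _ ((x ^+ v) ^+ p)); first by rewrite !expf_neq0.
  by apply: pspan_pow; rewrite expf_neq0.
rewrite -exprM -[X in _ * X]expr1 -exprD -uv mulnC exprM.
exact: pspanX.
Qed.

(** Steinitz exchange in the F_p-vector space of classes modulo pth powers: in [x = c^k y] either
    [p] divides [k] and [c^k] is absorbed, or [k] is invertible mod [p] and one solves for [c]. *)
Lemma pspan_exchange s c x : 0 \notin c :: s -> pspan p (c :: s) x ->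
  pspan p s x \/ pspan p (x :: s) c.
Proof.
move=> s0 sx; have x0 := pspan_neq0 s0 sx.
move: s0; rewrite inE negb_or eq_sym => /andP[c0 s0].
case: sx => k [y sy ->{x x0}].
have y0 := pspan_neq0 s0 sy; set x := _ * _.
have x0 : x != 0 by rewrite mulf_neq0 ?expf_neq0.
case: (boolP (p %| k)%N) => [/dvdnP[m Dk]|pk]; [left|right].
  by apply: pspanM sy; rewrite Dk exprM; apply: pspan_pow; rewrite expf_neq0.
apply: (pspan_root c0 pk); apply: (@pspanMl _ y) => //; last first.
  by rewrite mulrC; apply: pspan_mem; apply: mem_head.
by exists 0, y; rewrite ?mul1r.
Qed.

End PSpan.

Lemma pspan_morph (L M : fieldType) (f : {rmorphism L -> M}) p s x :
  pspan p s x -> pspan p (map f s) (f x).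
Proof.
elim: s x => [|c s IHs] x /=.
  by move=> [z z0 ->]; exists (f z); rewrite ?fmorph_eq0 ?rmorphXn.
by move=> [k [y /IHs sy ->]]; exists k, (f y); rewrite ?rmorphM ?rmorphXn.
Qed.

(** * Radical extensions and their norms *)

Section Irreducible.
Variables (L : fieldType) (p : nat) (c : L).
Hypotheses (p_pr : prime p) (cNp : ~ is_nz_pth_power p c) (c0 : c != 0).

Let p_gt0 : (0 < p)%N := prime_gt0 p_pr.

(* If q divides X^p - c, then X acts on L[X]/(q) with X^p = c; taking determinants, c^(deg q) is a pth power. *)
Lemma XnsubC_irreducible : irreducible_poly ('X^p - c%:P).
Proof.
split; first by rewrite size_XnsubC ?ltnS.
move=> q q1 qd; have Xp0 : 'X^p - c%:P != 0 :> {poly L}.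
  by rewrite -size_poly_eq0 size_XnsubC.
have q0 : q != 0 by apply: contraTneq qd => ->; rewrite dvd0p.
rewrite -dvdp_size_eqp // size_XnsubC //.
have := dvdp_leq Xp0 qd; rewrite size_XnsubC // leq_eqVlt => /predU1P[->//|q_lt].
case: cNp; set r := (lead_coef q)^-1 *: q.
have lq : (lead_coef q)^-1 != 0 by rewrite invr_eq0 lead_coef_eq0.
have sr : size r = size q by rewrite size_scale.
have rm : r \is monic by rewrite monicE lead_coefZ mulVf // lead_coef_eq0.
have rd : r %| 'X^p - c%:P by rewrite dvdpZl.
have : pspan p [::] (c ^+ (size q).-1); last first.
  apply: pspan_root => //; apply/negP => /dvdn_leq.
  move: q1 q_lt; rewrite -size_poly_gt0 in q0; case: (size q) q0 => // -[//|n] _ _ /=.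
  by rewrite ltnS => n_lt /(_ isT); rewrite leqNgt n_lt.
have n1 : (0 < (size q).-1)%N.
  by rewrite -size_poly_gt0 in q0; case: (size q) q0 q1 => // -[].
rewrite -sr in n1 *; case En: (size r).-1 n1 => [//|n] _.
have [A DA] : exists A : 'M[L]_n.+1, char_poly A = r.
  by rewrite -En; exists (companionmx r); apply: companionmxK.
have hA : A ^+ p = c%:M.
  apply/eqP; rewrite -subr_eq0 -(horner_mx_C A c) -[X in X ^+ p](horner_mx_X A).
  rewrite -rmorphXn -rmorphB /=; case/dvdpP: rd => g ->.
  by rewrite rmorphM /= -DA Cayley_Hamilton mulr0.
have detX k : \det (A ^+ k) = \det A ^+ k.
  by elim: k => [|k IHk]; rewrite ?expr0 ?det1 // !exprS -IHk -det_mulmx.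
exists (\det A); last by rewrite -detX hA det_scalar.
apply/eqP => dA0; move/eqP: (detX p); apply/negP.
by rewrite hA dA0 det_scalar expr0n gtn_eqF // expf_neq0.
Qed.

End Irreducible.

Section RadicalExtension.
Variables (L : fieldType) (p : nat) (zeta b : L).
Hypotheses (p_pr : prime p) (b0 : b != 0) (bNp : ~ is_nz_pth_power p b).
Let p_gt0 : (0 < p)%N := prime_gt0 p_pr.

Lemma radical_root_dvd (M : fieldType) (f : {rmorphism L -> M}) (beta : M) (q : {poly L}) :
  beta ^+ p = f b -> (map_poly f q).[beta] = 0 -> 'X^p - b%:P %| q.
Proof.
move=> Dbeta q0; apply: contraT; rewrite -irreducible_poly_coprime; last exact: XnsubC_irreducible.
rewrite -(coprimep_map f) => cop; have := coprimep_root cop (x := beta).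
by rewrite q0 eqxx /root rmorphB /= map_polyXn map_polyC /= !hornerE Dbeta subrr eqxx => /(_ isT).
Qed.

(** Equality at one pth root of [b] is a congruence modulo [X^p - b], hence passes to any other
    root. This makes conjugation and the extension of morphisms well defined. *)
Lemma eq_radical (M M' : fieldType) (f : {rmorphism L -> M}) (beta : M)
    (f' : {rmorphism L -> M'}) (beta' : M') (q r : {poly L}) :
  beta ^+ p = f b -> beta' ^+ p = f' b ->
  (map_poly f q).[beta] = (map_poly f r).[beta] ->
  (map_poly f' q).[beta'] = (map_poly f' r).[beta'].
Proof.
move=> Dbeta Dbeta' eq_qr; apply/eqP; rewrite -subr_eq0 -hornerN -hornerD -!rmorphB.
have /dvdpP[g ->] : 'X^p - b%:P %| q - r.
  by apply: (radical_root_dvd Dbeta); rewrite rmorphB hornerD hornerN eq_qr subrr.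
rewrite rmorphM /= rmorphB /= map_polyXn map_polyC /= !hornerE Dbeta' subrr.
by rewrite mulr0.
Qed.

Section Generator.
Variables (K : fieldExtType L) (beta : K).
Hypotheses (Dbeta : beta ^+ p = b%:A) (genK : <<1; beta>>%VS = fullv).

Lemma dim_radical : \dim {:K} = p.
Proof.
rewrite -genK dim_Fadjoin dimv1 muln1.
have /polyOver1P[q Dq] := minPolyOver 1 beta.
apply: succn_inj; rewrite -(size_minPoly 1 beta) -(size_XnsubC b p_gt0).
apply/eqP; rewrite -(size_map_poly (in_alg K) ('X^p - b%:P)) eqn_leq.
have rootX : root (map_poly (in_alg K) ('X^p - b%:P)) beta.
  by rewrite /root rmorphB /= map_polyXn map_polyC /= !hornerE Dbeta subrr.
rewrite dvdp_leq ?map_poly_eq0 -?size_poly_eq0 ?size_XnsubC //=; last first.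
  by apply: minPoly_dvdp => //; apply/polyOver1P; exists ('X^p - b%:P).
rewrite dvdp_leq ?monic_neq0 ?monic_minPoly // Dq dvdp_map.
apply: (@radical_root_dvd K (in_alg K) beta) => //; rewrite -Dq.
exact/eqP/root_minPoly.
Qed.

(** The boolean equality lets [xchoose] select a representing polynomial. *)
Lemma radical_poly (x : K) : exists q : {poly L}, x == (map_poly (in_alg K) q).[beta].
Proof.
have: x \in <<1; beta>>%VS by rewrite genK memvf.
by case/Fadjoin_polyP => _ /polyOver1P[q ->] ->; exists q.
Qed.

Hypothesis zeta_prim : p.-primitive_root zeta.

Lemma root_unity_radical (i : nat) : ((zeta ^+ i)%:A * beta) ^+ p = b%:A.
Proof.
by rewrite exprMn Dbeta exprZn exprAC (prim_expr_order zeta_prim) !expr1n scale1r mul1r.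
Qed.

(* Multiplication by y = q(beta) is diagonalised over K by the matrix (r_j(zeta^i beta)), where e_j = r_j(beta) is the chosen basis. *)
Lemma fieldNorm_radical (q : {poly L}) :
  (fieldNorm (map_poly (in_alg K) q).[beta])%:A
    = \prod_(i < p) (map_poly (in_alg K) q).[(zeta ^+ i)%:A * beta].
Proof.
set y := (_).[beta]; pose d : nat := \dim {:K}; have dE : d = p := dim_radical.
pose e : d.-tuple K := vbasis {:K}; have eB : basis_of {:K} e := vbasisP _.
have eval (i : nat) (s t : {poly L}) :
    (map_poly (in_alg K) s).[beta] = (map_poly (in_alg K) t).[beta] ->
    (map_poly (in_alg K) s).[(zeta ^+ i)%:A * beta]
      = (map_poly (in_alg K) t).[(zeta ^+ i)%:A * beta].
  by apply: (@eq_radical K K (in_alg K) beta (in_alg K)) => //; apply: root_unity_radical.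
have [r Dr] : exists r : 'I_d -> {poly L},
    forall j : 'I_d, e`_j = (map_poly (in_alg K) (r j)).[beta].
  exists (fun j : 'I_d => xchoose (radical_poly e`_j)) => j.
  exact/eqP/(xchooseP (radical_poly e`_j)).
have sum_r (c : 'I_d -> L) :
    \sum_j c j *: e`_j = (map_poly (in_alg K) (\sum_j c j *: r j)).[beta].
  rewrite rmorph_sum horner_sum; apply: eq_bigr => j _ /=.
  by rewrite map_polyZ hornerZ Dr mulr_algl.
pose V : 'M[K]_d := \matrix_(j, i) (map_poly (in_alg K) (r j)).[(zeta ^+ i)%:A * beta].
pose D : 'rV[K]_d := \row_i (map_poly (in_alg K) q).[(zeta ^+ i)%:A * beta].
have sumV (c : 'I_d -> L) (i : 'I_d) :
    \sum_j (c j)%:A * V j i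
      = (map_poly (in_alg K) (\sum_j c j *: r j)).[(zeta ^+ i)%:A * beta].
  rewrite rmorph_sum horner_sum; apply: eq_bigr => j _ /=.
  by rewrite map_polyZ hornerZ mxE.
pose A := passmx.mxof e e (amulr y).
have DA (j : 'I_d) : e`_j * y = \sum_k A j k *: e`_k.
  have -> : e`_j * y = amulr y e`_j by rewrite lfunE.
  have De : passmx.vecof e (delta_mx 0 j) = e`_j.
    rewrite /passmx.vecof (bigD1 j) //= mxE !eqxx scale1r big1 ?addr0 // => k kj.
    by rewrite mxE (negPf kj) andbF scale0r.
  rewrite -{1}De (passmx.hom_vecof e eB) -rowE /passmx.vecof.
  by apply: eq_bigr => k _; rewrite mxE.
have AV : map_mx (in_alg K) A *m V = V *m diag_mx D.
  apply/matrixP=> j i; rewrite mul_mx_diag !mxE.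
  under eq_bigr do rewrite mxE.
  rewrite sumV -hornerM -rmorphM; apply: eval.
  by rewrite -sum_r -DA rmorphM hornerM -Dr.
(* The matrix [C] of the powers of [beta] in the basis [e] turns [V] into the Vandermonde matrix of
   the points [zeta^i beta], which are distinct because [beta] is nonzero. *)
have detV : \det V != 0.
  pose C : 'M[L]_d := \matrix_(k, j) coord e j (beta ^+ k).
  have : map_mx (in_alg K) C *m V = Vandermonde d (\row_i ((zeta ^+ i)%:A * beta)).
    apply/matrixP => k i; rewrite !mxE.
    under eq_bigr do rewrite mxE.
    rewrite sumV -[RHS]hornerXn -(map_polyXn (in_alg K)); apply: eval.
    rewrite -sum_r map_polyXn hornerXn [RHS](coord_basis eB (memvf _)).
    by apply: eq_bigr => j _; rewrite mxE.
  move/(congr1 determinant); rewrite det_mulmx det_Vandermonde => detE.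
  suff: \det (map_mx (in_alg K) C) * \det V != 0 by rewrite mulf_eq0 => /norP[].
  rewrite detE; apply/prodf_neq0 => i _; apply/prodf_neq0 => j ij.
  rewrite !mxE subr_eq0 -subr_eq0 -mulrBl mulf_eq0 negb_or.
  rewrite -scalerBl scaler_eq0 oner_eq0 orbF subr_eq0 (eq_prim_root_expr zeta_prim) -dE !modn_small //.
  rewrite gtn_eqF //=; apply: contra b0 => /eqP beta0; move: Dbeta.
  by rewrite beta0 expr0n gtn_eqF // => /esym/eqP; rewrite scaler_eq0 oner_eq0 orbF.
have := congr1 determinant AV; rewrite !det_mulmx det_diag mulrC => /(mulfI detV).
rewrite det_map_mx => detE; transitivity (in_alg K (\det A)); first by [].
by rewrite detE -dE; apply: eq_bigr => i _; rewrite mxE.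
Qed.

(** [K] is [L[X]/(X^p - b)]: an element goes to the value at [beta'] of a chosen polynomial
    representing it, and by [eq_radical] the value does not depend on the choice. *)
Lemma radical_morphism (M : fieldType) (s : {rmorphism L -> M}) (beta' : M) :
  beta' ^+ p = s b ->
  exists S : {rmorphism K -> M},
    forall q, S (map_poly (in_alg K) q).[beta] = (map_poly s q).[beta'].
Proof.
move=> Dbeta'; pose q x := xchoose (radical_poly x).
have qE x : (map_poly (in_alg K) (q x)).[beta] = x.
  exact/esym/eqP/(xchooseP (radical_poly x)).
pose S x := (map_poly s (q x)).[beta'].
have SE r : S (map_poly (in_alg K) r).[beta] = (map_poly s r).[beta'].
  by apply: (@eq_radical K M (in_alg K) beta) => //; rewrite qE.
have SB : zmod_morphism S.
  move=> x y; rewrite -{1}[x]qE -{1}[y]qE -hornerN -hornerD -rmorphB SE.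
  by rewrite rmorphB hornerD hornerN.
have SM : monoid_morphism S.
  split=> [|x y]; last by rewrite -{1}[x]qE -{1}[y]qE -hornerM -rmorphM SE rmorphM hornerM.
  by have := SE 1; rewrite !rmorph1 !hornerC.
pose zB := GRing.isZmodMorphism.Build _ _ S SB.
pose mB := GRing.isMonoidMorphism.Build _ _ S SM.
pose SR : {rmorphism K -> M} := HB.pack S zB mB.
by exists SR.
Qed.

End Generator.

Lemma radical_extension :
  exists (K : fieldExtType L) (beta : K), beta ^+ p = b%:A /\ <<1; beta>>%VS = fullv.
Proof.
have [K _ [beta rb gK]] := irredp_FAdjoin (XnsubC_irreducible p_pr bNp b0).
exists K, beta; split=> //; move: rb.
by rewrite /root rmorphB /= map_polyXn map_polyC /= !hornerE subr_eq0 => /eqP.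
Qed.

End RadicalExtension.

(* When b is not a pth power, this says that n is the norm of q(b^(1/p)) from L(b^(1/p)). *)
Definition radical_norm (L : fieldType) p (zeta b n : L) : Prop :=
  exists q : {poly L}, 'X^p - b%:P %| \prod_(i < p) (q \Po (zeta ^+ i *: 'X)) - n%:P.

Section RadicalNorm.
Variables (L : fieldType) (p : nat) (zeta b : L).

Lemma horner_radical_norm (M : fieldType) (f : {rmorphism L -> M}) (beta : M) (q : {poly L}) :
  (map_poly f (\prod_(i < p) (q \Po (zeta ^+ i *: 'X)))).[beta]
    = \prod_(i < p) (map_poly f q).[f zeta ^+ i * beta].
Proof.
rewrite rmorph_prod horner_prod; apply: eq_bigr => i _ /=.
by rewrite map_comp_poly horner_comp map_polyZ map_polyX hornerZ hornerX rmorphXn.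
Qed.

Lemma radical_norm_root (M : fieldType) (f : {rmorphism L -> M}) (beta : M) n :
  beta ^+ p = f b -> radical_norm p zeta b n ->
  exists q : {poly L}, \prod_(i < p) (map_poly f q).[f zeta ^+ i * beta] = f n.
Proof.
move=> Dbeta [q /dvdpP[g Dg]]; exists q; rewrite -horner_radical_norm.
rewrite -[X in map_poly f X](subrK n%:P) Dg rmorphD rmorphM rmorphB /= map_polyXn.
by rewrite !map_polyC /= !hornerE Dbeta subrr mulr0 add0r.
Qed.

Hypotheses (p_pr : prime p) (b0 : b != 0) (bNp : ~ is_nz_pth_power p b).

(** Since [X^p - b] is irreducible, the congruence can be tested at a single root in any field over
    [L]. *)
Lemma root_radical_norm (M : fieldType) (f : {rmorphism L -> M}) (beta : M)
    (q : {poly L}) n :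
  beta ^+ p = f b -> \prod_(i < p) (map_poly f q).[f zeta ^+ i * beta] = f n ->
  radical_norm p zeta b n.
Proof.
move=> Dbeta Dn; exists q; apply: (@radical_root_dvd _ _ _ _ _ _ M f beta) => //.
by rewrite rmorphB /= map_polyC hornerD hornerN hornerC horner_radical_norm Dn subrr.
Qed.

Hypothesis zeta_prim : p.-primitive_root zeta.

Lemma p_rigid_radical_norm n :
  p_rigid L p -> n != 0 -> radical_norm p zeta b n -> pspan p [:: b] n.
Proof.
move=> rigL n0 nn; have [K [beta [Dbeta gK]]] := radical_extension p_pr b0 bNp.
have [q Dn] := @radical_norm_root K (in_alg K) beta n Dbeta nn.
have inj : injective (in_alg K) by apply: fmorph_inj.
have Dq : fieldNorm (map_poly (in_alg K) q).[beta] = n.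
  apply: inj; rewrite -Dn [LHS](fieldNorm_radical p_pr b0 bNp Dbeta gK zeta_prim).
  by apply: eq_bigr => i _; rewrite -rmorphXn.
have q0 : (map_poly (in_alg K) q).[beta] != 0.
  apply: contraNneq n0 => q0; rewrite -(fmorph_eq0 (in_alg K)) -Dn.
  by rewrite -(prednK (prime_gt0 p_pr)) big_ord_recl expr0 mul1r q0 mul0r.
have [k _ [z zp Dz]] := rigL b b0 bNp K beta Dbeta gK _ q0.
by exists k, z; rewrite // -Dq.
Qed.

End RadicalNorm.

(** * Cyclic norms and Hilbert 90 *)

Section IterMorphism.
Variables (M : fieldType) (f : {rmorphism M -> M}) (n : nat).

Lemma iter_zmod_morphism : zmod_morphism (iter n f).
Proof. by elim: n => // m IHm x y; rewrite !iterS IHm rmorphB. Qed.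

Lemma iter_monoid_morphism : monoid_morphism (iter n f).
Proof.
split; first by elim: n => // m IHm; rewrite iterS IHm rmorph1.
by elim: n => // m IHm x y; rewrite !iterS IHm rmorphM.
Qed.

HB.instance Definition _ := GRing.isZmodMorphism.Build M M (iter n f) iter_zmod_morphism.
HB.instance Definition _ := GRing.isMonoidMorphism.Build M M (iter n f) iter_monoid_morphism.

End IterMorphism.

Lemma iter_comm (T : Type) (f g : T -> T) n :
  (forall x, f (g x) = g (f x)) -> forall x, f (iter n g x) = iter n g (f x).
Proof. by move=> fg; elim: n => //= n IHn x; rewrite fg IHn. Qed.

(** For [r] of order [p] this is the norm to the fixed field of [r]. Working with automorphisms lets
    several subfields of one [M] be treated together. *)
Definition cyc_norm (M : fieldType) (p : nat) (r : M -> M) (x : M) : M :=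
  \prod_(i < p) iter i r x.

Section CyclicNorm.
Variables (M : fieldType) (p : nat) (r : {rmorphism M -> M}).

Lemma cyc_normM x y : cyc_norm p r (x * y) = cyc_norm p r x * cyc_norm p r y.
Proof. by rewrite /cyc_norm -big_split; apply: eq_bigr => i _; rewrite rmorphM. Qed.

Lemma cyc_norm1 : cyc_norm p r 1 = 1.
Proof. by apply: big1 => i _; rewrite rmorph1. Qed.

Lemma cyc_normX x n : cyc_norm p r (x ^+ n) = cyc_norm p r x ^+ n.
Proof. by elim: n => [|n IHn]; rewrite ?cyc_norm1 // !exprS cyc_normM IHn. Qed.

Lemma cyc_norm_fixed x : r x = x -> cyc_norm p r x = x ^+ p.
Proof.
move=> rx; rewrite /cyc_norm (eq_bigr (fun _ => x)) ?prodr_const ?card_ord //.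
by move=> i _; apply: iter_fix.
Qed.

Lemma cyc_norm_neq0 x : x != 0 -> cyc_norm p r x != 0.
Proof. by move=> x0; apply/prodf_neq0 => i _; rewrite fmorph_eq0. Qed.

Lemma cyc_normV x : x != 0 -> cyc_norm p r x^-1 = (cyc_norm p r x)^-1.
Proof.
move=> x0; have N0 := cyc_norm_neq0 x0; apply: (mulfI N0).
by rewrite -cyc_normM !divff // cyc_norm1.
Qed.

Lemma cyc_norm_comm (h : {rmorphism M -> M}) x :
  (forall x, h (r x) = r (h x)) -> h (cyc_norm p r x) = cyc_norm p r (h x).
Proof.
by move=> hr; rewrite rmorph_prod; apply: eq_bigr => i _; apply: iter_comm.
Qed.

Lemma cyc_norm_invariant x : (0 < p)%N -> iter p r x = x ->
  r (cyc_norm p r x) = cyc_norm p r x.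
Proof.
case: p => // n _ rx; rewrite rmorph_prod /cyc_norm big_ord_recr big_ord_recl /=.
by rewrite -[r (iter n r x)]/(iter n.+1 r x) rx mulrC.
Qed.

Hypotheses (p_odd : odd p) (z g : M).
Hypotheses (z_prim : p.-primitive_root z) (rz : r z = z) (rg : r g = z * g).

Lemma iter_eigen i : iter i r g = z ^+ i * g.
Proof.
elim: i => [|i IHi]; rewrite ?mul1r // iterS IHi rmorphM rmorphXn /= rz rg.
by rewrite mulrA -exprSr.
Qed.

(** The roots of unity multiply to [z^(p(p-1)/2)], which is 1 because [p] is odd. *)
Lemma cyc_norm_eigen : cyc_norm p r g = g ^+ p.
Proof.
rewrite /cyc_norm (eq_bigr (fun i : 'I_p => z ^+ i * g)); last first.
  by move=> i _; apply: iter_eigen.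
rewrite big_split /= prodr_const card_ord prodrXr -(big_mkord xpredT id) bin2_sum.
by rewrite bin2odd // exprM (prim_expr_order z_prim) expr1n mul1r.
Qed.

(* Hilbert 90: for theta = g^k the resolvent y_k = sum_i P_i r^i(theta) with P_i = x r(x) ... r^(i-1)(x) satisfies x r(y_k) = y_k, and by Vandermonde some y_k is nonzero. *)
Lemma hilbert90 x : g != 0 -> x != 0 -> iter p r x = x -> cyc_norm p r x = 1 ->
  exists y, [/\ y != 0, r y = x * y & forall h : {rmorphism M -> M},
    (forall x, h (r x) = r (h x)) -> h x = x -> h g = g -> h y = y].
Proof.
move=> g0 x0 rx Nx; have p_gt0 := prim_order_gt0 z_prim.
pose P i := \prod_(j < i) iter j r x; pose y k := \sum_(i < p) P i * iter i r (g ^+ k).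
have Py i : x * r (P i) = P i.+1 by rewrite rmorph_prod /P big_ord_recl.
have rgk k : iter p r (g ^+ k) = g ^+ k.
  by rewrite rmorphXn /= iter_eigen (prim_expr_order z_prim) mul1r.
have ry k : x * r (y k) = y k.
  rewrite /y; set th := g ^+ k; case Ep: p p_gt0 => [//|n] _.
  rewrite rmorph_sum mulr_sumr [RHS]big_ord_recl big_ord_recr /=.
  rewrite rmorphM mulrA Py -[r (iter n r th)]/(iter n.+1 r th) -Ep rgk.
  rewrite [P p]Nx addrC; congr (_ + _); first by rewrite /P big_ord0.
  by apply: eq_bigr => i _; rewrite rmorphM mulrA Py.
have [k yk0] : exists k : 'I_p, y k != 0.
  apply/existsP; rewrite -negb_forall; apply/negP => /forallP y0.
  (* If every [y k] vanishes, [Q] has the [p] distinct roots [z^k] and degree below [p]; yet its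
     constant coefficient [P 0] is the empty product 1. *)
  pose Q := \poly_(i < p) P i.
  have: Q = 0.
    apply: (@roots_geq_poly_eq0 _ _ [seq z ^+ i | i <- iota 0 p]) => /=.
    - apply/allP => t /mapP[k]; rewrite mem_iota => /andP[_ kp] ->{t}.
      have := y0 (Ordinal kp); rewrite /root horner_poly => /eqP yk.
      have /eqP : g ^+ k * (\sum_(i < p) P i * (z ^+ k) ^+ i) = 0.
        rewrite -[RHS]yk mulr_sumr; apply: eq_bigr => i _.
        by rewrite rmorphXn /= iter_eigen exprMn exprAC mulrCA [_ * g ^+ k]mulrC.
      by rewrite mulf_eq0 expf_eq0 (negPf g0) andbF.
    - rewrite map_inj_in_uniq ?iota_uniq // => i j; rewrite !mem_iota /= => ip jp.
      by move/eqP; rewrite (eq_prim_root_expr z_prim) !modn_small // => /eqP.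
    by rewrite size_map size_iota size_poly.
  move/polyP => /(_ 0); rewrite coef_poly p_gt0 coef0 /P big_ord0 => /eqP.
  by rewrite oner_eq0.
(* Inverting turns [x * r (y k) = y k] into the required relation. A map [h] as in the last clause
   fixes the resolvent term by term, so the solution stays in the fixed field of [h]. *)
exists (y k)^-1; rewrite invr_eq0; split=> // [|h hr hx hg].
  by rewrite fmorphV -{2}[y k]ry invfM mulrA mulfV ?mul1r.
have hiter i w : h (iter i r w) = iter i r (h w) by apply: iter_comm.
rewrite fmorphV rmorph_sum; congr (_^-1); apply: eq_bigr => i _.
rewrite rmorphM rmorph_prod hiter rmorphXn /= hg; congr (_ * _).
by apply: eq_bigr => j _; rewrite hiter hx.
Qed.

End CyclicNorm.

(** * Powers of r - 1 acting on the multiplicative group *)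

Lemma coef_XsubC1_exp_prime (p i : nat) : prime p -> (0 < i < p)%N ->
  exists m : int, (('X - 1) ^+ p : {poly int})`_i = m *+ p.
Proof.
move=> p_pr /andP[i_gt0 i_lt]; rewrite exprDn coef_sum.
suff: (p%:Z %| \sum_(j < p.+1) ('X^(p - j) * (- 1) ^+ j *+ 'C(p, j) : {poly int})`_i)%Z.
  by case/dvdzP => m ->; exists m; rewrite -mulr_natr natz.
apply: rpred_sum => j _.
rewrite coefMn -mulr_natr natz; case: (posnP j) => [->|j_gt0].
  by rewrite subn0 expr0 mulr1 coefXn ltn_eqF // mul0r dvdz0.
have := ltn_ord j; rewrite ltnS leq_eqVlt => /predU1P[->|j_lt].
  by rewrite subnn mul1r -[- 1]/(- (1%:P)) -polyCN -polyC_exp coefC gtn_eqF // mul0r dvdz0.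
by rewrite dvdz_mull // dvdzE /= prime_dvd_bin // j_gt0.
Qed.

Section RatioIteration.
Variables (M : fieldType) (r : {rmorphism M -> M}).

(** The action of [r - 1], written multiplicatively. *)
Definition ratio (x : M) : M := r x / x.

Lemma ratioM x y : ratio (x * y) = ratio x * ratio y.
Proof. by rewrite /ratio rmorphM invfM mulrACA. Qed.

Lemma iter_ratioM n x y : iter n ratio (x * y) = iter n ratio x * iter n ratio y.
Proof. by elim: n => // n IHn; rewrite !iterS IHn ratioM. Qed.

Lemma iter_ratioX n x k : iter n.+1 ratio (x ^+ k) = iter n.+1 ratio x ^+ k.
Proof.
rewrite !iterSr; have -> : ratio (x ^+ k) = ratio x ^+ k by rewrite /ratio rmorphXn expr_div_n.
by elim: n => // n IHn; rewrite !iterS IHn /ratio rmorphXn expr_div_n.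
Qed.

(** The multiplicative group is a module over Z[X] with X acting as [r], and here [(X - 1)^k] acts.
    The freedom in [n] absorbs the index shift caused by one more application of [r]. *)
Lemma iter_ratio_exprz (x : M) k n : x != 0 -> (k < n)%N ->
  iter k ratio x = \prod_(i < n) iter i r x ^ (('X - 1) ^+ k : {poly int})`_i.
Proof.
move=> x0; elim: k n => [|k IHk] [//|n] kn.
  rewrite big_ord_recl big1 ?mulr1 => [|i _].
    by rewrite expr0 coef1 expr1z.
  by rewrite expr0 coef1 lift0 mulr0n expr0z.
rewrite iterS /ratio {1}(IHk n) // (IHk n.+1) 1?ltnW // rmorph_prod.
rewrite exprS; set Q := (_ ^+ k).
have -> : \prod_(i < n) r (iter i r x ^ Q`_i) = \prod_(i < n.+1) iter i r x ^ ('X * Q)`_i.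
  rewrite big_ord_recl coefXM expr0z mul1r; apply: eq_bigr => i _.
  by rewrite coefXM lift0 /= fmorphXz.
rewrite -prodfV -big_split; apply: eq_bigr => i _ /=.
by rewrite mulrBl mul1r coefB expfzDr ?fmorph_eq0 // invr_expz.
Qed.

(* In the group ring F_p[Z/p] one has (r - 1)^p = r^p - 1 = 0. *)
Lemma iter_ratio_pth_power (p : nat) (x : M) :
  prime p -> odd p -> x != 0 -> iter p r x = x ->
  exists w, [/\ w != 0, iter p ratio x = w ^+ p & forall h : {rmorphism M -> M},
    (forall x, h (r x) = r (h x)) -> h x = x -> h w = w].
Proof.
move=> p_pr p_odd x0 rx; have p_gt0 := prime_gt0 p_pr.
rewrite (@iter_ratio_exprz _ p p.+1) // big_ord_recr /= rx.
have [m Dm] : exists m : nat -> int, forall i, (0 < i < p)%N ->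
    (('X - 1) ^+ p : {poly int})`_i = m i *+ p.
  exists (fun i => ((('X - 1) ^+ p : {poly int})`_i %/ p)%Z) => i /coef_XsubC1_exp_prime.
  by case=> // k ->; rewrite -(mulr_natr k) natz mulzK ?eqz_nat -?lt0n // -[RHS]mulr_natr natz.
exists (\prod_(i < p | (0 < i)%N) iter i r x ^ m i); split=> [||h hr hx].
- by apply/prodf_neq0 => i _; rewrite expfz_neq0 // fmorph_eq0.
- rewrite (bigD1 (Ordinal p_gt0)) //= mulrC mulrA.
  (* Since [p] is odd, the extreme coefficients are 1 and -1; as [r^p] fixes [x], the two outer
     factors cancel. *)
  have -> : x ^ (('X - 1) ^+ p : {poly int})`_p * x ^ (('X - 1) ^+ p : {poly int})`_0 = 1.
    rewrite -expfzDr // -horner_coef0 horner_exp !hornerE -[in X in X + _]polyC1.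
    rewrite -signr_odd p_odd expr1.
    have /monicP : ('X - 1%:P : {poly int}) ^+ p \is monic by rewrite monic_exp ?monicXsubC.
    by rewrite lead_coefE size_exp_XsubC => ->.
  rewrite mul1r -prodrXl; apply: eq_big => [i|i i0]; first by rewrite -lt0n.
  rewrite Dm; last by rewrite lt0n ltn_ord andbT.
  by rewrite -mulr_natr natz -exprz_exp.
by rewrite rmorph_prod; apply: eq_bigr => i _; rewrite fmorphXz (iter_comm _ hr) hx.
Qed.

End RatioIteration.

(** * Kummer extensions of a rigid field *)

(* {x | h x = x} is a Kummer extension of iota F generated by g, a pth root of c, with Galois group generated by r. *)
Record kummer (F M : fieldType) (iota : {rmorphism F -> M}) (p : nat) (zeta c : F)
    (h r : {rmorphism M -> M}) (g : M) : Prop := Kummer {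
  kummer_rootX : g ^+ p = iota c;
  kummer_root_fix : h g = g;
  kummer_root : r g = iota zeta * g;
  kummer_comm : forall x, h (r x) = r (h x);
  kummer_base_fix : forall x, h (iota x) = iota x;
  kummer_base : forall x, r (iota x) = iota x;
  kummer_order : forall x, h x = x -> iter p r x = x;
  kummer_fixed : forall x, h x = x -> r x = x -> exists e, x = iota e }.

Lemma sum_prim_root_expr (M : fieldType) (p j : nat) (w : M) :
  p.-primitive_root w -> (0 < j < p)%N -> \sum_(k < p) w ^+ (k * j) = 0.
Proof.
move=> w_prim /andP[j0 jp]; have wj1 : w ^+ j - 1 != 0.
  rewrite subr_eq0 -(expr0 w) (eq_prim_root_expr w_prim) mod0n modn_small //.
  by rewrite -lt0n.
apply: (mulfI wj1); rewrite mulr0.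
under eq_bigr do rewrite mulnC exprM.
by rewrite -subrX1 exprAC (prim_expr_order w_prim) expr1n subrr.
Qed.

Section Kummer.
Variables (F M : fieldType) (iota : {rmorphism F -> M}) (p : nat) (zeta c : F).
Variables (h r : {rmorphism M -> M}) (g : M).
Hypotheses (p_pr : prime p) (p_odd : odd p) (zeta_prim : p.-primitive_root zeta).
Hypotheses (c0 : c != 0) (kum : kummer iota p zeta c h r g).

Let p_gt0 : (0 < p)%N := prime_gt0 p_pr.

Lemma kummer_zeta_prim : p.-primitive_root (iota zeta).
Proof. by rewrite fmorph_primitive_root. Qed.

Lemma kummer_neq0 : g != 0.
Proof.
have := kummer_rootX kum; apply: contra_eq_neq => ->.
by rewrite expr0n gtn_eqF // eq_sym fmorph_eq0.
Qed.

Lemma kummer_iter i : iter i r g = iota (zeta ^+ i) * g.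
Proof.
rewrite rmorphXn; apply: iter_eigen; first exact: (kummer_base kum).
exact: (kummer_root kum).
Qed.

Lemma kummer_iter_base i x : iter i r (iota x) = iota x.
Proof. exact/iter_fix/(kummer_base kum). Qed.

Lemma kummer_iter_fix i x : h x = x -> h (iter i r x) = iter i r x.
Proof. by move=> hx; rewrite (iter_comm _ (kummer_comm kum)) hx. Qed.

Lemma kummer_norm_base x : h x = x -> exists n, cyc_norm p r x = iota n.
Proof.
move=> hx; apply: (kummer_fixed kum).
  by rewrite (cyc_norm_comm _ _ (kummer_comm kum)) hx.
exact/cyc_norm_invariant/(kummer_order kum).
Qed.

(* The decomposition of x into eigenvectors of r; the eigenspace of zeta^k is g^k F. *)
Lemma kummer_poly x : h x = x -> exists q : {poly F}, x = (map_poly iota q).[g].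
Proof.
move=> hx; have z_prim := kummer_zeta_prim; have g0 := kummer_neq0.
set z := iota zeta in z_prim; have rz : r z = z by apply: (kummer_base kum).
have hz : h z = z by apply: (kummer_base_fix kum).
have z0 : z != 0 by rewrite (prim_root_eq0 z_prim) -lt0n.
have zp : z ^+ p = 1 := prim_expr_order z_prim.
have w_prim : p.-primitive_root z^-1.
  rewrite -[z^-1]mul1r -zp -[X in z ^+ X](prednK p_gt0) exprSr mulfK //.
  by rewrite prim_root_exp_coprime // coprime_sym coprimenP.
pose e k := \sum_(j < p) z ^- (k * j) * iter j r x.
have re k : r (e k) = z ^+ k * e k.
  have -> : r (e k) = z ^+ k * \sum_(j < p) z ^- (k * j.+1) * iter j.+1 r x.
    rewrite rmorph_sum mulr_sumr; apply: eq_bigr => j _.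
    rewrite rmorphM fmorphV rmorphXn /= rz mulrA; congr (_ * _).
    by rewrite mulnS exprD invfM mulrA mulfV ?expf_neq0 // mul1r.
  congr (_ * _); rewrite /e; case Ep: p => [|n]; first by rewrite !big_ord0.
  rewrite [RHS]big_ord_recl big_ord_recr /= addrC; congr (_ + _).
  rewrite -Ep muln0 expr0 invr1 mulnC exprM zp expr1n invr1.
  by rewrite -[r (iter n r x)]/(iter n.+1 r x) -Ep (kummer_order kum).
have [d Dd] : exists d : nat -> F, forall k, e k = iota (d k) * g ^+ k.
  have dP k : exists d, e k == iota d * g ^+ k.
    have hek : h (e k / g ^+ k) = e k / g ^+ k.
      rewrite rmorphM fmorphV rmorphXn /= (kummer_root_fix kum); congr (_ / _).
      rewrite rmorph_sum; apply: eq_bigr => j _.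
      by rewrite rmorphM fmorphV rmorphXn /= hz kummer_iter_fix.
    have [|d Dd] := kummer_fixed kum hek.
      rewrite rmorphM fmorphV rmorphXn /= (kummer_root kum) re exprMn invfM mulrACA.
      by rewrite divff ?expf_neq0 // mul1r.
    by exists d; rewrite -Dd mulfVK // expf_neq0.
  by exists (fun k => xchoose (dP k)) => k; apply/eqP/(xchooseP (dP k)).
exists (p%:R^-1 *: \poly_(k < p) d k).
have p0 : p%:R != 0 :> F := prim_root_natf_neq0 zeta_prim.
rewrite map_polyZ hornerZ fmorphV; apply/esym/(canLR (mulKf _)).
  by rewrite fmorph_eq0.
rewrite rmorph_nat.
have -> : (map_poly iota (\poly_(k < p) d k)).[g] = \sum_(k < p) e k.
  rewrite (poly_def p d) rmorph_sum horner_sum; apply: eq_bigr => k _ /=.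
  by rewrite map_polyZ map_polyXn hornerZ hornerXn Dd.
rewrite exchange_big /= (bigD1 (Ordinal p_gt0)) //= [X in _ + X]big1 ?addr0 => [|j j0].
  rewrite -mulr_suml (eq_bigr (fun _ => 1)) ?sumr_const ?card_ord // => k _.
  by rewrite muln0 expr0 invr1.
rewrite -mulr_suml (eq_bigr (fun k : 'I_p => z^-1 ^+ (k * j))) => [|k _]; last by rewrite exprVn.
by rewrite sum_prim_root_expr ?mul0r // lt0n ltn_ord andbT.
Qed.

(** The quotient [r w / w] is a pth root of unity [zeta^i], so [w / g^i] is fixed by [h] and [r] and
    lies in the base field. *)
Lemma kummer_pth_power w a : h w = w -> a != 0 -> w ^+ p = iota a -> pspan p [:: c] a.
Proof.
move=> hw a0 Dw; have g0 := kummer_neq0.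
have w0 : w != 0.
  by move: Dw; apply: contra_eq_neq => ->; rewrite expr0n gtn_eqF // eq_sym fmorph_eq0.
have [i Di] : {i : 'I_p | r w / w = iota zeta ^+ i}.
  apply: (prim_rootP kummer_zeta_prim).
  by rewrite expr_div_n -rmorphXn /= Dw (kummer_base kum) divff // fmorph_eq0.
have [||e De] := kummer_fixed kum (x := w / g ^+ i).
- by rewrite rmorphM fmorphV rmorphXn /= hw (kummer_root_fix kum).
- rewrite rmorphM fmorphV rmorphXn /= (kummer_root kum) exprMn invfM -Di.
  by rewrite invf_div mulrA [r w * _]mulrC mulfVK ?fmorph_eq0.
have e0 : e != 0 by rewrite -(fmorph_eq0 iota) -De mulf_neq0 ?invr_eq0 ?expf_neq0.
exists i, (e ^+ p); first by exists e.
apply: (fmorph_inj iota); rewrite -Dw -[w](mulfVK (expf_neq0 i g0)) De.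
by rewrite exprMn rmorphM !rmorphXn /= -(kummer_rootX kum) exprAC mulrC.
Qed.

Lemma iter_kummer_horner i (q : {poly F}) :
  iter i r (map_poly iota q).[g] = (map_poly iota q).[iota zeta ^+ i * g].
Proof.
rewrite -horner_map -map_poly_comp /= kummer_iter rmorphXn; congr (_.[_]).
by apply: eq_map_poly => u /=; rewrite kummer_iter_base.
Qed.

Lemma radical_norm_kummer n : radical_norm p zeta c n ->
  exists2 x, h x = x & cyc_norm p r x = iota n.
Proof.
move=> /(radical_norm_root (kummer_rootX kum))[q Dn].
exists (map_poly iota q).[g].
  rewrite -horner_map -map_poly_comp /= (kummer_root_fix kum); congr (_.[_]).
  by apply: eq_map_poly => u /=; rewrite (kummer_base_fix kum).
by rewrite -Dn; apply: eq_bigr => i _; apply: iter_kummer_horner.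
Qed.

Hypothesis cNp : ~ is_nz_pth_power p c.

(** Every element fixed by [h] is some [q(g)], with conjugates [q(zeta^i g)]. With
    [radical_norm_kummer] this translates between polynomial congruences and cyclic norms. *)
Lemma kummer_radical_norm x n : h x = x -> cyc_norm p r x = iota n ->
  radical_norm p zeta c n.
Proof.
move=> hx Dn; have [q Dx] := kummer_poly hx.
apply: (root_radical_norm (q := q) p_pr c0 cNp (kummer_rootX kum)).
by rewrite -Dn Dx; apply: eq_bigr => i _; rewrite iter_kummer_horner.
Qed.

Hypothesis rigF : p_rigid F p.

Lemma kummer_norm_span x : h x = x -> x != 0 ->
  exists2 n, cyc_norm p r x = iota n & pspan p [:: c] n.
Proof.
move=> hx x0; have [n Dn] := kummer_norm_base hx; exists n => //.
apply: (p_rigid_radical_norm p_pr c0 cNp zeta_prim rigF).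
  by rewrite -(fmorph_eq0 iota) -Dn cyc_norm_neq0.
exact: kummer_radical_norm hx Dn.
Qed.

Lemma kummer_norm_root : cyc_norm p r g = iota c.
Proof.
rewrite -(kummer_rootX kum); apply: (cyc_norm_eigen p_odd kummer_zeta_prim).
  exact: (kummer_base kum).
exact: (kummer_root kum).
Qed.

(** Rigidity makes the norm of [x] equal to [c^k a^p], which is also the norm of [g^k a] because [g]
    has norm [c] for odd [p]. The quotient has norm 1, and Hilbert 90 applies. *)
Lemma kummer_ratio_decomposition x : h x = x -> x != 0 -> exists k a z,
  [/\ a != 0, z != 0, h z = z & x = g ^+ k * iota a * ratio r z].
Proof.
move=> hx x0; have g0 := kummer_neq0.
have [n Dn [k [_ [a a0 ->] Dk]]] := kummer_norm_span hx x0.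
have a0' : iota a != 0 by rewrite fmorph_eq0.
pose u := g ^+ k * iota a; have u0 : u != 0 by rewrite mulf_neq0 ?expf_neq0.
have hu : h u = u.
  by rewrite rmorphM rmorphXn /= (kummer_root_fix kum) (kummer_base_fix kum).
have Nu : cyc_norm p r u = iota n.
  rewrite cyc_normM cyc_normX kummer_norm_root cyc_norm_fixed ?(kummer_base kum) //.
  by rewrite Dk rmorphM !rmorphXn.
have hxu : h (x / u) = x / u by rewrite rmorphM fmorphV hx hu.
have [||||y [y0 Dy hy]] := hilbert90 kummer_zeta_prim _ (kummer_root kum) g0 _ (x := x / u).
- exact: (kummer_base kum).
- by rewrite mulf_neq0 ?invr_eq0.
- exact: (kummer_order kum).
- by rewrite cyc_normM cyc_normV // Dn Nu mulfV // -Nu cyc_norm_neq0.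
exists k, a, y; split=> //.
  by apply: hy => //; [apply: (kummer_comm kum)|apply: (kummer_root_fix kum)].
by rewrite /ratio Dy mulfK // -/u mulrC mulfVK.
Qed.

(** Iterating the previous decomposition [p] times leaves [(r - 1)^p] applied to some [z], which is
    a pth power. *)
Lemma kummer_decomposition x : h x = x -> x != 0 -> exists k a w,
  [/\ a != 0, w != 0, h w = w & x = g ^+ k * iota a * w ^+ p].
Proof.
move=> hx x0; have g0 := kummer_neq0.
suff [k [a [z [a0 z0 hz ->]]]] : exists k a z,
    [/\ a != 0, z != 0, h z = z & x = g ^+ k * iota a * iter p (ratio r) z].
  have [|w [w0 -> hw]] := iter_ratio_pth_power p_pr p_odd z0 (_ : iter p r z = z).
    exact: (kummer_order kum).
  exists k, a, w; split=> //; apply: hw => //; exact: (kummer_comm kum).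
rewrite -(prednK p_gt0); elim: p.-1 => [|n [k [a [z [a0 z0 hz ->]]]]].
  exact: kummer_ratio_decomposition.
have [l [b [y [b0 y0 hy ->]]]] := kummer_ratio_decomposition hz z0.
have b0' : iota b != 0 by rewrite fmorph_eq0.
have rat_base u : u != 0 -> ratio r (iota u) = 1.
  by move=> u0; rewrite /ratio (kummer_base kum) divff // fmorph_eq0.
have iter_rat1 m : iter m (ratio r) 1 = 1.
  by apply: iter_fix; rewrite /ratio rmorph1 divr1.
have rat_g : ratio r g = iota zeta by rewrite /ratio (kummer_root kum) mulfK.
have z0F : zeta != 0 by rewrite (prim_root_eq0 zeta_prim) -lt0n.
(* Applying [r - 1] sends [g] to [zeta] and base elements to 1. After at least one application, the
   factor [g^l b] of [z] therefore contributes only an element of [F]. *)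
have [d d0 Dd] : exists2 d, d != 0 & iter n.+1 (ratio r) g = iota d.
  rewrite iterSr rat_g; case: n => [|m]; first by exists zeta.
  by exists 1; rewrite ?oner_neq0 // iterSr rat_base // iter_rat1 rmorph1.
exists k, (a * d ^+ l), y; split=> //; first by rewrite mulf_neq0 ?expf_neq0.
rewrite 2!iter_ratioM iter_ratioX Dd [iter _ _ (iota b)]iterSr rat_base // iter_rat1.
by rewrite mulr1 -iterSr rmorphM rmorphXn !mulrA.
Qed.

End Kummer.

(** * Bicyclic extensions *)

(* M is a Galois extension of iota F with group Z/p x Z/p, generated by the pth roots x of a and y of f. *)
Record bicyclic (F M : fieldType) (iota : {rmorphism F -> M}) (p : nat) (zeta a f : F)
    (s t : {rmorphism M -> M}) (x y : M) : Prop := Bicyclic {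
  bicyclic_rootX1 : x ^+ p = iota a;
  bicyclic_rootX2 : y ^+ p = iota f;
  bicyclic_s1 : s x = iota zeta * x;
  bicyclic_s2 : s y = y;
  bicyclic_t1 : t x = x;
  bicyclic_t2 : t y = iota zeta * y;
  bicyclic_comm : forall u, s (t u) = t (s u);
  bicyclic_s_base : forall u, s (iota u) = iota u;
  bicyclic_t_base : forall u, t (iota u) = iota u;
  bicyclic_s_order : forall u, iter p s u = u;
  bicyclic_t_order : forall u, iter p t u = u;
  bicyclic_fixed : forall u, s u = u -> t u = u -> exists e, u = iota e }.

Lemma bicyclic_sym (F M : fieldType) (iota : {rmorphism F -> M}) p zeta a f s t x y :
  bicyclic iota p zeta a f s t x y -> bicyclic iota p zeta f a t s y x.
Proof. by case=> *; split=> // u *; eauto. Qed.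

Lemma bicyclic_kummer (F M : fieldType) (iota : {rmorphism F -> M}) p zeta a f s t x y :
  bicyclic iota p zeta a f s t x y -> kummer iota p zeta a t s x.
Proof. by case=> *; split=> // *; eauto. Qed.

Section Bicyclic.
Variables (F M : fieldType) (iota : {rmorphism F -> M}) (p : nat) (zeta a f : F).
Variables (s t : {rmorphism M -> M}) (x y : M).
Hypotheses (p_pr : prime p) (p_odd : odd p) (zeta_prim : p.-primitive_root zeta).

Let p_gt0 : (0 < p)%N := prime_gt0 p_pr.

Hypotheses (a0 : a != 0) (f0 : f != 0).
Hypothesis (bic : bicyclic iota p zeta a f s t x y).

Let zetap : iota zeta ^+ p = 1.
Proof. by rewrite -rmorphXn (prim_expr_order zeta_prim) rmorph1. Qed.

(** [s^k t] fixes [x y^(p - k)] because the factors [zeta^k] and [zeta^(p - k)] multiply to 1;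
    [p - k] stands for [-k] to keep the exponent natural. *)
Lemma bicyclic_kummer_diagonal k : (k <= p)%N ->
  kummer iota p zeta (a * f ^+ (p - k)) (iter k s \o t) s (x * y ^+ (p - k)).
Proof.
move=> kp; have sb := bicyclic_s_base bic.
have iterb i u : iter i s (iota u) = iota u by apply: iter_fix.
split=> [||| u | u | u | u _ | u hu su] /=.
- rewrite exprMn exprAC (bicyclic_rootX1 bic) (bicyclic_rootX2 bic).
  by rewrite rmorphM rmorphXn.
- have Dx : iter k s x = iota zeta ^+ k * x by apply: iter_eigen; rewrite // (bicyclic_s1 bic).
  have Dy : iter k s y = y by apply: iter_fix; apply: (bicyclic_s2 bic).
  rewrite rmorphM (bicyclic_t1 bic) rmorphXn /= (bicyclic_t2 bic) exprMn.
  have -> u v w : iter k s (u * (v * w)) = iter k s u * (iter k s v * iter k s w).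
    by rewrite !rmorphM.
  rewrite -rmorphXn iterb [iter k s (_ ^+ _)]rmorphXn /= Dx Dy mulrACA.
  by rewrite rmorphXn -exprD subnKC // zetap mul1r.
- by rewrite rmorphM rmorphXn /= (bicyclic_s1 bic) (bicyclic_s2 bic) mulrA.
- by rewrite -(bicyclic_comm bic) -iterSr.
- by rewrite (bicyclic_t_base bic) iterb.
- exact: sb.
- exact: (bicyclic_s_order bic).
apply: (bicyclic_fixed bic su); rewrite -[RHS]hu /= iter_fix //.
by rewrite (bicyclic_comm bic) su.
Qed.

(** If [t w = zeta^i w], then [w / y^i] lies in the fixed field of [t], where cyclic Kummer theory
    applies. *)
Lemma bicyclic_pth_power w b : b != 0 -> w ^+ p = iota b -> pspan p [:: a; f] b.
Proof.
move=> b0 Dw; have kt := bicyclic_kummer bic; have ks := bicyclic_kummer (bicyclic_sym bic).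
have y0 : y != 0 := kummer_neq0 p_pr f0 ks.
have w0 : w != 0.
  by move: Dw; apply: contra_eq_neq => ->; rewrite expr0n gtn_eqF // eq_sym fmorph_eq0.
have [i Di] : {i : 'I_p | t w / w = iota zeta ^+ i}.
  apply: (prim_rootP (kummer_zeta_prim iota zeta_prim)).
  by rewrite expr_div_n -rmorphXn /= Dw (bicyclic_t_base bic) divff // fmorph_eq0.
have b'0 : b / f ^+ i != 0 by rewrite mulf_neq0 ?invr_eq0 ?expf_neq0.
have := @kummer_pth_power _ _ _ _ _ _ _ _ _ p_pr zeta_prim a0 kt (w / y ^+ i) _ _ b'0.
case=> [||k [z zp Dz]].
- rewrite rmorphM fmorphV rmorphXn /= (bicyclic_t2 bic) exprMn invfM -Di.
  by rewrite invf_div mulrA [t w * _]mulrC mulfVK ?fmorph_eq0.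
- by rewrite expr_div_n exprAC (bicyclic_rootX2 bic) Dw fmorph_div rmorphXn.
exists k, (f ^+ i * z); first by exists i, z.
by rewrite -[LHS](mulfVK (expf_neq0 i f0)) Dz mulrC mulrCA.
Qed.

Lemma cyc_norm_comp u : cyc_norm p s (cyc_norm p t u) = cyc_norm p t (cyc_norm p s u).
Proof.
rewrite /cyc_norm; under eq_bigr do rewrite rmorph_prod.
rewrite exchange_big; apply: eq_bigr => i _ /=; rewrite rmorph_prod.
apply: eq_bigr => j _ /=; rewrite (@iter_comm _ (iter i t) s) // => v.
by rewrite -(@iter_comm _ s t) //; apply: (bicyclic_comm bic).
Qed.

Lemma iter_diagonal k i u : iter i (iter k s \o t) u = iter (k * i) s (iter i t u).
Proof.
elim: i => [|i IHi]; first by rewrite muln0.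
rewrite iterS IHi /= mulnS iterD; congr (iter k s _); rewrite -iterS.
by apply: iter_comm => v; rewrite (bicyclic_comm bic).
Qed.

Lemma prod_iter_mul i u : (0 < i < p)%N ->
  \prod_(k < p) iter (k * i) s u = cyc_norm p s u.
Proof.
move=> /andP[i0 ip]; have iter_mod n : iter (n %% p) s u = iter n s u.
  rewrite [in RHS](divn_eq n p) addnC iterD iterM.
  by congr (iter _ s _); rewrite iter_fix //; apply: (bicyclic_s_order bic).
pose m (k : 'I_p) : 'I_p := Ordinal (ltn_pmod (k * i) p_gt0).
have m_inj : injective m.
  have pi : coprime p i by rewrite prime_coprime // gtnNdvd.
  suff m_le (k l : 'I_p) : (l <= k)%N -> m k = m l -> k = l.
    by move=> k l; case: (leqP l k) => [|/ltnW] lk mkl; [|symmetry]; apply: m_le.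
  move=> lk /(congr1 val)/eqP /=; rewrite eqn_mod_dvd ?leq_mul // -mulnBl Gauss_dvdl //.
  have kl_lt : (k - l < p)%N by apply: leq_ltn_trans (leq_subr _ _) _.
  case: (posnP (k - l)) => [/eqP kl _|kl_gt0 /dvdn_leq-/(_ kl_gt0)]; last by rewrite leqNgt kl_lt.
  by apply/val_inj/eqP; rewrite eqn_leq lk -subn_eq0 kl.
rewrite /cyc_norm [RHS](reindex_inj m_inj).
by apply: eq_bigr => k _ /=; rewrite iter_mod.
Qed.

(** The group has [p + 1] subgroups of order [p], generated by [s] and by the [s^k t] with [k < p].
    The identity lies in all of them and every other element in exactly one. *)
Lemma prod_bicyclic_norms u :
  (\prod_(k < p) cyc_norm p (iter k s \o t) u) * cyc_norm p s u
    = u ^+ p * cyc_norm p s (cyc_norm p t u).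
Proof.
pose G i := \prod_(k < p) iter (k * i) s (iter i t u).
have -> : \prod_(k < p) cyc_norm p (iter k s \o t) u = \prod_(i < p) G i.
  rewrite exchange_big; apply: eq_bigr => k _.
  by apply: eq_bigr => i _; rewrite iter_diagonal.
have -> : cyc_norm p s (cyc_norm p t u) = \prod_(i < p) cyc_norm p s (iter i t u).
  rewrite {2}/cyc_norm; elim/big_ind2: _ => // [|v1 v2 w1 w2 <- <-].
    exact: cyc_norm1.
  exact: cyc_normM.
rewrite (bigD1 (Ordinal p_gt0)) //= [X in _ = _ * X](bigD1 (Ordinal p_gt0)) //=.
have -> : G 0 = u ^+ p.
  rewrite /G (eq_bigr (fun _ => u)) ?prodr_const ?card_ord // => k _.
  by rewrite muln0.
rewrite mulrAC mulrA; congr (_ * _).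
by apply: eq_bigr => i i0; rewrite /G prod_iter_mul // lt0n ltn_ord andbT.
Qed.

(** The norm under [s] absorbs the powers of [s] by which the conjugates under [s^k t] and [t]
    differ. *)
Lemma cyc_norm_diagonal k u :
  cyc_norm p s (cyc_norm p (iter k s \o t) u) = cyc_norm p s (cyc_norm p t u).
Proof.
have Ns v : cyc_norm p s (s v) = cyc_norm p s v.
  rewrite -(@cyc_norm_comm _ p s s v (fun _ => erefl)).
  exact/cyc_norm_invariant/(bicyclic_s_order bic).
have Nsn n v : cyc_norm p s (iter n s v) = cyc_norm p s v.
  by elim: n => // n IHn; rewrite iterS Ns.
rewrite {2 4}/cyc_norm; elim/big_ind2: _ => // [v1 v2 w1 w2|i _].
  by rewrite !cyc_normM => -> ->.
by rewrite iter_diagonal Nsn.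
Qed.

End Bicyclic.

(** * Norms in bicyclic extensions of a rigid field *)

Section RigidBicyclic.
Variables (F M : fieldType) (iota : {rmorphism F -> M}) (p : nat) (zeta : F).
Hypotheses (p_pr : prime p) (p_odd : odd p) (zeta_prim : p.-primitive_root zeta).
Hypothesis (rigF : p_rigid F p).

Let p_gt0 : (0 < p)%N := prime_gt0 p_pr.

(** Write [u = x^k b w^p], where rigidity puts the norm [n] of [w] in the span of [c]. Norms give
    [c^k (b n)^p = g^p], so [k = l p], and taking pth roots [c^l b n = zeta^i g]. Hence
    [m = zeta^i / n] works. *)
Lemma kummer_norm_pth_power (c : F) (h r : {rmorphism M -> M}) (x u : M) (g : F) :
  c != 0 -> ~ is_nz_pth_power p c -> kummer iota p zeta c h r x ->
  h u = u -> u != 0 -> g != 0 -> cyc_norm p r u = iota g ^+ p ->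
  exists m w, [/\ pspan p [:: zeta; c] m, w != 0 & u = iota (g * m) * w ^+ p].
Proof.
move=> c0 cNp kum hu u0 g0 Nu.
have [k [b [w [b0 w0 hw Du]]]] := kummer_decomposition p_pr p_odd zeta_prim c0 kum cNp rigF hu u0.
have [n Dn sn] := kummer_norm_span p_pr zeta_prim c0 kum cNp rigF hw w0.
have n0 : n != 0 by rewrite -(fmorph_eq0 iota) -Dn cyc_norm_neq0.
have Dg : c ^+ k * (b * n) ^+ p = g ^+ p.
  apply: (fmorph_inj iota); rewrite !rmorphM !rmorphXn /= -Nu Du !cyc_normM !cyc_normX.
  rewrite (kummer_norm_root p_odd zeta_prim kum) Dn.
  by rewrite cyc_norm_fixed ?(kummer_base kum) // rmorphM exprMn mulrA.
have bn0 : b * n != 0 by rewrite mulf_neq0.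
have [l Dk] : exists l, k = (l * p)%N.
  apply/dvdnP/negP => /negP pk; apply: cNp; apply: (pspan_root (s := [::]) p_pr c0 pk).
  exists (g / (b * n)); first by rewrite mulf_neq0 ?invr_eq0.
  by rewrite expr_div_n -Dg mulfK // expf_neq0.
have [i Di] : {i : 'I_p | (c ^+ l * (b * n)) / g = zeta ^+ i}.
  apply: (prim_rootP zeta_prim).
  by rewrite expr_div_n exprMn -exprM -Dk Dg divff // expf_neq0.
exists (zeta ^+ i * n^-1), w; split=> //.
  exists i, n^-1 => //; apply: pspanV => //.
rewrite Du Dk mulnC exprM (kummer_rootX kum) -rmorphXn -rmorphM; congr (iota _ * _).
by rewrite -Di mulrA [g * _]mulrC mulfVK // mulrA mulfK.
Qed.

Variables (a f : F) (s t : {rmorphism M -> M}) (x y : M).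
Hypotheses (a0 : a != 0) (f0 : f != 0).
Hypotheses (aNf : ~ pspan p [:: f] a) (fNp : ~ is_nz_pth_power p f).
Hypothesis (bic : bicyclic iota p zeta a f s t x y).

Let zeta0 : zeta != 0.
Proof. by rewrite (prim_root_eq0 zeta_prim) -lt0n. Qed.

Let aNp : ~ is_nz_pth_power p a.
Proof. by case=> z z0 Da; apply: aNf; rewrite Da; apply: pspan_pow. Qed.

(* Up to pth powers, the norm of u to each of the p + 1 intermediate fields of degree p is g times an element of the span, while their product is u^p g^p. *)
Lemma bicyclic_norm_span u g : g != 0 -> u != 0 -> cyc_norm p t u = iota g ->
  pspan p [:: zeta; a; f] g.
Proof.
move=> g0 u0 Nu; pose S := [:: zeta; a; f].
have Nsu : cyc_norm p s (cyc_norm p t u) = iota g ^+ p.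
  by rewrite Nu cyc_norm_fixed // (bicyclic_s_base bic).
(* The exponent [j] counts the norms multiplied so far, each contributing one factor [g]. *)
pose Q j v := exists m w, [/\ pspan p S m, w != 0 & v = iota (g ^+ j * m) * w ^+ p].
have QM j k v w : Q j v -> Q k w -> Q (j + k)%N (v * w).
  move=> [m1 [w1 [sm1 w10 ->]]] [m2 [w2 [sm2 w20 ->]]].
  exists (m1 * m2), (w1 * w2); split; [exact: pspanM|exact: mulf_neq0|].
  by rewrite exprMn mulrACA -rmorphM exprD mulrACA.
have Sz : pspan p S zeta by apply: pspan_mem; rewrite !inE eqxx.
have Sa : pspan p S a by apply: pspan_mem; rewrite !inE eqxx orbT.
have Sf : pspan p S f by apply: pspan_mem; rewrite !inE eqxx !orbT.
have Q_norm c (h r : {rmorphism M -> M}) v : c != 0 -> ~ is_nz_pth_power p c ->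
    pspan p S c -> kummer iota p zeta c h r v ->
    (forall w, iter p h w = w) -> cyc_norm p r (cyc_norm p h u) = iota g ^+ p ->
    Q 1%N (cyc_norm p h u).
  move=> c0 cNp Sc kum hp Nrh.
  have hN : h (cyc_norm p h u) = cyc_norm p h u by apply: cyc_norm_invariant.
  have [m [w [sm w0 ->]]] := kummer_norm_pth_power c0 cNp kum hN (cyc_norm_neq0 _ _ u0) g0 Nrh.
  exists m, w; split=> //; apply: pspan_sub sm => d; rewrite !inE.
  by case/pred2P=> ->.
have Q_diag k : (k <= p)%N -> Q 1%N (cyc_norm p (iter k s \o t) u).
  move=> kp; have kum := bicyclic_kummer_diagonal zeta_prim bic kp.
  apply: (Q_norm _ _ _ _ _ _ _ kum); first by rewrite mulf_neq0 ?expf_neq0.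
  (* If [a f^(p - k)] were a pth power, [a] would lie in the span of [f]. *)
  - move=> sc; apply: aNf; apply: (@pspanMl _ _ p_pr _ (f ^+ (p - k))).
    + by rewrite expf_neq0.
    + by apply/pspanX/pspan_mem/mem_head.
    rewrite mulrC; case: sc => z z0 ->; exact: pspan_pow.
  - by apply: pspanM => //; apply: pspanX.
  - move=> w; rewrite (iter_diagonal bic) (bicyclic_t_order bic).
    by rewrite iterM iter_fix //; apply: (bicyclic_s_order bic).
  by rewrite (cyc_norm_diagonal p_pr bic).
have Qs : Q 1%N (cyc_norm p s u).
  apply: (Q_norm _ _ _ _ _ _ _ (bicyclic_kummer (bicyclic_sym bic))) => //.
    exact: (bicyclic_s_order bic).
  by rewrite -(cyc_norm_comp bic).
have Qprod n : (n <= p)%N -> Q n (\prod_(k < n) cyc_norm p (iter k s \o t) u).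
  elim: n => [|n IHn] np.
    rewrite big_ord0; exists 1, 1; rewrite oner_neq0 expr1n !mulr1 rmorph1.
    by split=> //; apply: pspan1.
  rewrite big_ord_recr /= -[X in Q X]addn1.
  by apply: QM; [apply/IHn/ltnW|apply/Q_diag/ltnW].
have [m [w [sm w0 Dm]]] := QM _ _ _ _ (Qprod p (leqnn p)) Qs.
have g0' : iota g != 0 by rewrite fmorph_eq0.
have m0 : m != 0.
  by apply: pspan_neq0 sm; rewrite !inE !negb_or ![0 == _]eq_sym zeta0 a0 f0.
(* The [p + 1] norms multiply to [g^(p + 1) m w^p] and also to [u^p g^p]. *)
have : (u / w) ^+ p = iota (g * m).
  apply: (mulfI (expf_neq0 p g0')); apply: (mulIf (expf_neq0 p w0)).
  rewrite expr_div_n -mulrA mulfVK ?expf_neq0 // mulrC -[in LHS]Nsu.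
  rewrite -(prod_bicyclic_norms p_pr bic) Dm -rmorphXn -rmorphM.
  by rewrite exprD expr1 !mulrA.
move/(bicyclic_pth_power p_pr zeta_prim a0 f0 bic (mulf_neq0 g0 m0)) => sgm.
apply: (pspanMl p_pr m0 sm); rewrite mulrC.
by apply: pspan_sub sgm => d; rewrite !inE => /pred2P[] ->.
Qed.

End RigidBicyclic.

(** * Existence of automorphisms *)

Section ExtensionConstruction.
Variables (p : nat).
Hypothesis p_pr : prime p.
Let p_gt0 : (0 < p)%N := prime_gt0 p_pr.

Lemma rmorph_horner (L K M : fieldType) (f : {rmorphism L -> K}) (s : {rmorphism K -> M})
    (q : {poly L}) x : s (map_poly f q).[x] = (map_poly (s \o f) q).[s x].
Proof. by rewrite -horner_map -map_poly_comp. Qed.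

Section Radical.
Variables (L : fieldType) (zeta b : L) (K : fieldExtType L) (beta : K).
Hypotheses (zeta_prim : p.-primitive_root zeta) (b0 : b != 0).
Hypotheses (bNp : ~ is_nz_pth_power p b).
Hypotheses (Dbeta : beta ^+ p = b%:A) (genK : <<1; beta>>%VS = fullv).

Lemma eq_rmorph_radical (M : fieldType) (s t : {rmorphism K -> M}) :
  (forall e : L, s e%:A = t e%:A) -> s beta = t beta -> s =1 t.
Proof.
move=> st st_beta x; have /eqP-> := xchooseP (radical_poly genK x).
set q := xchoose _; rewrite !(rmorph_horner (in_alg K)) st_beta.
by congr (_.[_]); apply: eq_map_poly => e /=; apply: st.
Qed.

Lemma radical_kummer : exists r : {rmorphism K -> K},
  kummer (in_alg K) p zeta b idfun r beta.
Proof.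
have [|r Dr] := @radical_morphism _ _ _ p_pr b0 bNp K beta Dbeta genK K (in_alg K) (zeta%:A * beta).
  by have := root_unity_radical Dbeta zeta_prim 1; rewrite expr1.
have r_base e : r e%:A = e%:A by have := Dr e%:P; rewrite !map_polyC !hornerC.
have r_beta : r beta = zeta%:A * beta by have := Dr 'X; rewrite !map_polyX !hornerX.
have z_prim : p.-primitive_root (in_alg K zeta) by rewrite fmorph_primitive_root.
exists r; split=> // [x _|x _ rx].
  apply: (eq_rmorph_radical (s := iter p r) (t := idfun)) => [e|] /=.
    exact/iter_fix/r_base.
  rewrite (iter_eigen (z := in_alg K zeta)) //; last exact: r_base.
  by rewrite (prim_expr_order z_prim) mul1r.
have [q Dx sq] : exists2 q : {poly L}, x = (map_poly (in_alg K) q).[beta] & (size q <= p)%N.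
  have /eqP Dx := xchooseP (radical_poly genK x); set q := xchoose _ in Dx.
  exists (q %% ('X^p - b%:P)); last first.
    rewrite -ltnS -(size_XnsubC b p_gt0) ltn_modp.
    by rewrite -size_poly_eq0 size_XnsubC.
  rewrite Dx {1}(divp_eq q ('X^p - b%:P)) rmorphD rmorphM rmorphB /= map_polyXn.
  by rewrite map_polyC !hornerE /= Dbeta subrr mulr0 add0r.
(* [d] represents [r x - x]. Divisible by [X^p - b] and of degree below [p], it vanishes; since
   [zeta^i] is not 1 for [0 < i < p], only the constant coefficient of [q] survives. *)
pose d := \poly_(i < p) ((zeta ^+ i - 1) * q`_i).
have: 'X^p - b%:P %| d.
  apply: (@radical_root_dvd _ _ _ p_pr b0 bNp K (in_alg K) beta) => //.
  have -> : 0 = r x - x by rewrite rx subrr.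
  rewrite Dx Dr !(horner_coef_wide (n := p)) ?size_map_poly ?size_poly // -sumrN -big_split.
  apply: eq_bigr => i _ /=; rewrite !coef_map /= coef_poly ltn_ord exprMn exprZn expr1n.
  by rewrite !mulr_algl scalerA -scalerBl mulrBl mul1r [q`_i * _]mulrC.
move/dvdp_leq; case: (eqVneq d 0) => [d0 _|_ /(_ isT)]; last first.
  by rewrite size_XnsubC // leqNgt ltnS size_poly.
exists q`_0; rewrite Dx (horner_coef_wide (n := p)) ?size_map_poly //.
rewrite (bigD1 (Ordinal p_gt0)) //= coef_map expr0 mulr1 big1 ?addr0 // => i i0.
have := congr1 (fun h : {poly L} => h`_i) d0; rewrite coef_poly ltn_ord coef0 => /eqP.
rewrite mulf_eq0 subr_eq0 -(expr0 zeta) (eq_prim_root_expr zeta_prim) mod0n modn_small //.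
by rewrite -[i == 0 :> nat]/(i == Ordinal p_gt0) (negPf i0) /= coef_map => /eqP->; rewrite /= scale0r mul0r.
Qed.

End Radical.

(** [M] is [E(f^(1/p))]: [t] comes from Kummer theory over [E], and [s] extends the automorphism of
    [E] by fixing [beta], which is possible since that automorphism fixes [f]. *)
Lemma bicyclic_extension (F : fieldType) (zeta a f : F) (E : fieldExtType F) (alpha : E) :
  p.-primitive_root zeta -> a != 0 -> ~ is_nz_pth_power p a ->
  alpha ^+ p = a%:A -> <<1; alpha>>%VS = fullv ->
  f != 0 -> ~ is_nz_pth_power p (f%:A : E) ->
  exists (M : fieldType) (kappa : {rmorphism E -> M}) (s t : {rmorphism M -> M}) (beta : M),
    kummer kappa p zeta%:A f%:A idfun t beta /\
    bicyclic (kappa \o in_alg E) p zeta a f s t (kappa alpha) beta.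
Proof.
move=> zeta_prim a0 aNp Dalpha genE f0 fNp.
have fE0 : f%:A != 0 :> E by rewrite (fmorph_eq0 (in_alg E)).
have zE_prim : p.-primitive_root (zeta%:A : E) by rewrite (fmorph_primitive_root (in_alg E)).
have [s0 ks0] := radical_kummer zeta_prim a0 aNp Dalpha genE.
have [K [beta [Dbeta genK]]] := radical_extension p_pr fE0 fNp.
have [t kt] := radical_kummer zE_prim fE0 fNp Dbeta genK.
have [|s Ds] := @radical_morphism _ _ _ p_pr fE0 fNp K beta Dbeta genK K (in_alg K \o s0) beta.
  by rewrite Dbeta /=; congr (_ *: _); rewrite (kummer_base ks0).
have s_base (e : E) : s e%:A = (s0 e)%:A by have := Ds e%:P; rewrite !map_polyC !hornerC.
have s_beta : s beta = beta by have := Ds 'X; rewrite !map_polyX !hornerX.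
have t_base (e : E) : t e%:A = e%:A := kummer_base kt e.
have t_beta : t beta = in_alg K zeta%:A * beta := kummer_root kt.
have s0_base (e : F) : s0 e%:A = e%:A := kummer_base ks0 e.
exists K, (in_alg K), s, t, beta; split=> //; split=> //=.
- by rewrite exprZn expr1n Dalpha.
- by rewrite s_base (kummer_root ks0) [RHS]mulr_algl scalerA.
- apply: (eq_rmorph_radical genK (s := s \o t) (t := t \o s)) => [e|] /=.
    by rewrite t_base s_base t_base.
  by rewrite s_beta t_beta rmorphM /= s_base s0_base s_beta.
- by move=> u; rewrite s_base s0_base.
- move=> u; apply: (eq_rmorph_radical genK (s := iter p s) (t := idfun)) => [e|] /=.
    have -> n : iter n s e%:A = (iter n s0 e)%:A by elim: n => //= n ->; rewrite s_base.
    by rewrite (kummer_order ks0).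
  exact: iter_fix.
- by move=> u; apply: (kummer_order kt).
move=> u su tu; have [e De] := kummer_fixed kt (erefl u) tu.
have s0e : s0 e = e by apply: (fmorph_inj (in_alg K)); rewrite /= -s_base -[e%:A]De.
by have [d Dd] := kummer_fixed ks0 (erefl e) s0e; exists d; rewrite De Dd.
Qed.

End ExtensionConstruction.

(** * Symmetry of the norm relation *)

Section RadicalNormGroup.
Variables (L : fieldType) (p : nat) (zeta : L).
Hypotheses (p_pr : prime p) (p_odd : odd p) (zeta_prim : p.-primitive_root zeta).
Let p_gt0 : (0 < p)%N := prime_gt0 p_pr.

Lemma radical_normM b m n :
  radical_norm p zeta b m -> radical_norm p zeta b n -> radical_norm p zeta b (m * n).
Proof.
move=> [q dq] [r dr]; exists (q * r).
under eq_bigr do rewrite comp_polyM.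
rewrite big_split polyCM /=; set A := \prod_i _ in dq *; set B := \prod_i _ in dr *.
have -> : A * B - m%:P * n%:P = (A - m%:P) * B + m%:P * (B - n%:P).
  by rewrite mulrBl mulrBr addrA subrK.
by apply: dvdp_add; [apply: dvdp_mulr|apply: dvdp_mull].
Qed.

Lemma radical_norm_pow b e : radical_norm p zeta b (e ^+ p).
Proof.
exists e%:P; under eq_bigr do rewrite comp_polyC.
by rewrite prodr_const card_ord polyC_exp subrr dvdp0.
Qed.

Lemma radical_norm_root_self b : radical_norm p zeta b b.
Proof.
exists 'X; under eq_bigr do rewrite comp_polyX.
suff -> : \prod_(i < p) (zeta ^+ i *: 'X) = 'X^p :> {poly L} by rewrite dvdpp.
rewrite scaler_prod prodr_const card_ord prodrXr -(big_mkord xpredT id) bin2_sum.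
by rewrite bin2odd // exprM (prim_expr_order zeta_prim) expr1n scale1r.
Qed.

Lemma radical_norm_span b s x :
  (forall c, c \in s -> radical_norm p zeta b c) -> pspan p s x -> radical_norm p zeta b x.
Proof.
elim: s x => [|c s IHs] x /= sub; first by case=> z _ ->; apply: radical_norm_pow.
case=> k [y /IHs sy ->]; apply: radical_normM; last first.
  by apply: sy => d sd; apply: sub; rewrite inE sd orbT.
elim: k => [|k IHk]; first by rewrite expr0 -(expr1n _ p); apply: radical_norm_pow.
by rewrite exprS; apply: radical_normM => //; apply/sub/mem_head.
Qed.

(** A pth root of [b e^p] is [e] times one of [b], so [e X] is substituted for [X]. *)
Lemma radical_norm_scale b e n : b != 0 -> ~ is_nz_pth_power p b ->
  radical_norm p zeta (b * e ^+ p) n -> radical_norm p zeta b n.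
Proof.
move=> b0 bNp; have [K [beta [Dbeta _]]] := radical_extension p_pr b0 bNp.
case/(@radical_norm_root _ _ _ _ K (in_alg K) (beta * e%:A)) => [|q Dn].
  by rewrite exprMn Dbeta exprZn expr1n mulr_algl scalerA.
apply: (@root_radical_norm _ _ _ _ p_pr b0 bNp K (in_alg K) beta (q \Po (e *: 'X))) => //.
rewrite -Dn; apply: eq_bigr => i _.
rewrite map_comp_poly horner_comp map_polyZ map_polyX hornerZ hornerX.
by congr (_.[_]); rewrite /= mulrC mulrA.
Qed.

(* Let x in M = L(b^(1/p), c^(1/p)) have norm c from L(b^(1/p)) to L. By Hilbert 90, x = c^(1/p) s(y)/y, and then t(y)/y * b^(1/p) is fixed by s and has norm b under t. *)
Lemma radical_norm_sym b c : b != 0 -> c != 0 -> ~ is_nz_pth_power p b ->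
  ~ pspan p [:: b] c -> radical_norm p zeta b c -> radical_norm p zeta c b.
Proof.
move=> b0 c0 bNp cNb norm_c.
have cNp : ~ is_nz_pth_power p c by case=> z z0 Dc; apply: cNb; rewrite Dc; apply: pspan_pow.
have [E [alpha [Dalpha genE]]] := radical_extension p_pr b0 bNp.
have [r kr] := radical_kummer p_pr zeta_prim b0 bNp Dalpha genE.
have cENp : ~ is_nz_pth_power p (c%:A : E).
  case=> z z0 Dz; apply: cNb.
  exact: (kummer_pth_power p_pr zeta_prim b0 kr (w := z)).
have [M [kappa [s [t [beta [kt bic]]]]]] :=
  bicyclic_extension p_pr zeta_prim b0 bNp Dalpha genE c0 cENp.
set iota := GRing.RMorphism.clone _ _ (kappa \o in_alg E) _ in bic.
set x := kappa alpha in bic.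
have kst := bicyclic_kummer bic; have kts := bicyclic_kummer (bicyclic_sym bic).
have x0 := kummer_neq0 p_pr b0 kst; have beta0 := kummer_neq0 p_pr c0 kts.
have z_prim := kummer_zeta_prim iota zeta_prim.
have z0 : iota zeta != 0 by rewrite fmorph_eq0 (prim_root_eq0 zeta_prim) -lt0n.
have [u tu Nu] := radical_norm_kummer kst norm_c.
have u0 : u != 0.
  apply: contra c0 => /eqP u0; rewrite -(fmorph_eq0 iota) -Nu u0 /cyc_norm.
  by rewrite (bigD1 (Ordinal p_gt0)) //= mul0r.
have [||||y [y0 sy _]] := hilbert90 z_prim _ (kummer_root kst) x0 _ (x := u / beta).
- exact: (kummer_base kst).
- by rewrite mulf_neq0 ?invr_eq0.
- exact: (bicyclic_s_order bic).
- rewrite cyc_normM cyc_normV // Nu (cyc_norm_fixed _ (bicyclic_s2 bic)).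
  by rewrite (bicyclic_rootX2 bic) divff // fmorph_eq0.
(* As [t] fixes [u], it multiplies [u / beta] by [zeta^-1]; this cancels the [zeta] of
   [s x = zeta x] when [s] is applied to [v]. *)
have tub : t (u / beta) = (iota zeta)^-1 * (u / beta).
  by rewrite fmorph_div tu (bicyclic_t2 bic) invfM mulrCA.
have ub0 : u / beta != 0 by rewrite mulf_neq0 ?invr_eq0.
pose v := t y / y * x.
have sv : s v = v.
  rewrite /v rmorphM fmorph_div (bicyclic_comm bic) sy rmorphM tub (kummer_root kst).
  by field; rewrite z0 y0 u0 beta0.
apply: (kummer_radical_norm p_pr zeta_prim c0 kts cNp sv).
rewrite cyc_normM (cyc_norm_fixed _ (bicyclic_t1 bic)) (bicyclic_rootX1 bic).
rewrite cyc_normM cyc_normV // -(@cyc_norm_comm _ p t t y (fun _ => erefl)).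
rewrite cyc_norm_invariant ?(bicyclic_t_order bic) //.
by rewrite divff ?mul1r // cyc_norm_neq0.
Qed.

End RadicalNormGroup.

(** * Rigidity of E *)

Section RigidExtension.
Variables (p : nat) (F : fieldType) (zeta a : F) (E : fieldExtType F) (alpha : E).
Hypotheses (p_pr : prime p) (p_odd : odd p) (zeta_prim : p.-primitive_root zeta).
Hypotheses (a0 : a != 0) (aNp : ~ is_nz_pth_power p a).
Hypotheses (Dalpha : alpha ^+ p = a%:A) (genE : <<1; alpha>>%VS = fullv).
Hypothesis rigF : p_rigid F p.
Let p_gt0 : (0 < p)%N := prime_gt0 p_pr.

Let zeta0 : zeta != 0.
Proof. by rewrite (prim_root_eq0 zeta_prim) -lt0n. Qed.

Lemma pth_power_ext_span f : f != 0 ->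
  is_nz_pth_power p (f%:A : E) <-> pspan p [:: a] f.
Proof.
move=> f0; split=> [[w w0 Dw]|[k [_ [z z0 ->] Df]]].
  have [r kr] := radical_kummer p_pr zeta_prim a0 aNp Dalpha genE.
  exact: (kummer_pth_power p_pr zeta_prim a0 kr (w := w)).
exists (alpha ^+ k * z%:A).
  rewrite mulf_neq0 ?(fmorph_eq0 (in_alg E)) // expf_neq0 //.
  apply: contraNneq a0 => alpha0; rewrite -(fmorph_eq0 (in_alg E)) /= -Dalpha alpha0.
  by rewrite expr0n gtn_eqF.
by rewrite Df exprMn exprAC Dalpha -!(rmorphXn (in_alg E)) -(rmorphM (in_alg E)).
Qed.

(** As [a] is not a pth power, exchange turns [a] in the span of [f] into [f] in the span of [a],
    which would make [f] a pth power in [E]. *)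
Let fNp_ext f : f != 0 -> ~ is_nz_pth_power p (f%:A : E) ->
  ~ is_nz_pth_power p f /\ ~ pspan p [:: f] a.
Proof.
move=> f0 fENp; have fNa : ~ pspan p [:: a] f by move/(pth_power_ext_span f0).
split=> [[z z0 Df]|saf]; first by apply: fNa; rewrite Df; apply: pspan_pow.
have [||//] := pspan_exchange p_pr _ saf; last exact: aNp.
by rewrite inE eq_sym.
Qed.

(** The norm of [n] to [F] is [a^k] times a pth power. Taking the two norms from [M] in the other
    order shows it to be a norm from [F(f^(1/p))], so rigidity puts it in the span of [f]. *)
Lemma radical_norm_exponent (f g : F) (n e : E) k :
  f != 0 -> ~ is_nz_pth_power p (f%:A : E) -> g != 0 -> e != 0 ->
  n = alpha ^+ k * g%:A * e ^+ p -> radical_norm p zeta%:A f%:A n ->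
  pspan p [:: f] (a ^+ k).
Proof.
move=> f0 fENp g0 e0 Dn norm_n; have [fNp _] := fNp_ext f0 fENp.
have [M [kappa [s [t [beta [kt bic]]]]]] :=
  bicyclic_extension p_pr zeta_prim a0 aNp Dalpha genE f0 fENp.
have [u _ Nu] := radical_norm_kummer kt norm_n.
have kst := bicyclic_kummer bic; have kts := bicyclic_kummer (bicyclic_sym bic).
have te : t (kappa e) = kappa e := kummer_base kt e.
have [e1 De1] := kummer_norm_base p_pr kst te.
have e10 : e1 != 0 by rewrite -(fmorph_eq0 (kappa \o in_alg E)) -De1 cyc_norm_neq0 // fmorph_eq0.
have alpha0 : alpha != 0 by rewrite -(fmorph_eq0 kappa) (kummer_neq0 p_pr a0 kst).
have n0 : n != 0 by rewrite Dn !mulf_neq0 ?expf_neq0 ?(fmorph_eq0 (in_alg E)).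
have u0 : u != 0.
  apply: contra n0 => /eqP u0; rewrite -(fmorph_eq0 kappa) -Nu u0 /cyc_norm.
  by rewrite (bigD1 (Ordinal p_gt0)) //= mul0r.
have sNu : s (cyc_norm p s u) = cyc_norm p s u.
  exact/cyc_norm_invariant/(bicyclic_s_order bic).
have [m Dm sm] := kummer_norm_span p_pr zeta_prim f0 kts fNp rigF sNu (cyc_norm_neq0 _ _ u0).
have Em : m = a ^+ k * (g * e1) ^+ p.
  apply: (fmorph_inj (kappa \o in_alg E)); rewrite -Dm -(cyc_norm_comp bic) Nu Dn.
  rewrite !rmorphM !rmorphXn !cyc_normM !cyc_normX (kummer_norm_root p_odd zeta_prim kst).
  rewrite De1 [cyc_norm _ _ (kappa g%:A)]cyc_norm_fixed; last exact: (kummer_base kst).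
  by rewrite rmorphM exprMn mulrA.
apply: (@pspanMl _ _ p_pr _ ((g * e1) ^+ p)); first by rewrite expf_neq0 ?mulf_neq0.
  by apply: pspan_pow; rewrite mulf_neq0.
by rewrite mulrC -Em.
Qed.

Lemma radical_norm_base_span (f g : F) : f != 0 -> ~ is_nz_pth_power p (f%:A : E) ->
  g != 0 -> radical_norm p (zeta%:A : E) f%:A g%:A -> pspan p [:: zeta; a; f] g.
Proof.
move=> f0 fENp g0 norm_g; have [fNp aNf] := fNp_ext f0 fENp.
have [M [kappa [s [t [beta [kt bic]]]]]] :=
  bicyclic_extension p_pr zeta_prim a0 aNp Dalpha genE f0 fENp.
have [u _ Nu] := radical_norm_kummer kt norm_g.
have u0 : u != 0.
  apply: contra g0 => /eqP u0; rewrite -(fmorph_eq0 (kappa \o in_alg E)) /= -Nu u0 /cyc_norm.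
  by rewrite (bigD1 (Ordinal p_gt0)) //= mul0r.
exact: (bicyclic_norm_span p_pr p_odd zeta_prim rigF a0 f0 aNf fNp bic g0 u0).
Qed.

Lemma pspan_ext (t : seq F) (s : seq E) f :
  (forall c, c \in t -> pspan p s c%:A) -> pspan p t f -> pspan p s f%:A.
Proof.
move=> sub /(pspan_morph (in_alg E)); apply: pspan_sub => _ /mapP[c tc ->].
exact: sub.
Qed.

Lemma pspan_ext_root (s : seq E) : pspan p s a%:A.
Proof.
rewrite -Dalpha; apply: pspan_pow; apply: contraNneq a0 => alpha0.
by rewrite -(fmorph_eq0 (in_alg E)) /= -Dalpha alpha0 expr0n gtn_eqF.
Qed.

Lemma base_norm_span (f g : F) : f != 0 -> ~ is_nz_pth_power p (f%:A : E) ->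
  g != 0 -> radical_norm p (zeta%:A : E) f%:A g%:A -> pspan p [:: f%:A : E] g%:A.
Proof.
move=> f0 fENp g0 norm_g; have [fNp aNf] := fNp_ext f0 fENp.
have fNa : ~ pspan p [:: a] f by move/(pth_power_ext_span f0).
have zE_prim : p.-primitive_root (zeta%:A : E) by rewrite (fmorph_primitive_root (in_alg E)).
suff saf : pspan p [:: a; f] g.
  apply: pspan_ext saf => c; rewrite !inE => /pred2P[] ->; first exact: pspan_ext_root.
  by apply: pspan_mem; rewrite inE.
have s_zaf := radical_norm_base_span f0 fENp g0 norm_g.
apply: NNPP => gN; have zN : ~ pspan p [:: a; f] zeta.
  move=> sz; apply: gN; apply: pspan_sub s_zaf => c; rewrite inE => /predU1P[->//|].
  exact: pspan_mem.
(* Exchange puts [zeta] in the span of [g], [a] and [f]. Over [E] these are all norms: [g] by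
   hypothesis, [a] as a pth power, [f] as the norm of its root. *)
have [|//|/(pspan_morph (in_alg E)) s_gaf] := pspan_exchange p_pr _ s_zaf.
  by rewrite !inE !negb_or ![0 == _]eq_sym zeta0 a0.
have norm_z : radical_norm p (zeta%:A : E) f%:A zeta%:A.
  apply: radical_norm_span s_gaf => c; rewrite !inE => /or3P[]/eqP->; first exact: norm_g.
    by rewrite /= -Dalpha; apply: radical_norm_pow.
  exact: radical_norm_root_self.
have fk0 k : f ^+ k != 0 by rewrite expf_neq0.
(* Otherwise some [zeta / f^k] is a pth power in [E], hence in the span of [a] over [F]. *)
have zfN : ~ pspan p [:: f%:A : E] zeta%:A.
  case=> k [_ [z z0 ->] Dz]; apply: zN.
  have : pspan p [:: a] (zeta / f ^+ k).
    apply/(pth_power_ext_span (mulf_neq0 zeta0 (invr_neq0 (fk0 k)))); exists z => //.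
    have fkE0 : (f ^+ k)%:A != 0 :> E by rewrite (fmorph_eq0 (in_alg E)).
    apply: (mulIf fkE0); rewrite -(rmorphM (in_alg E)) mulfVK //= Dz mulrC.
    by rewrite exprZn expr1n.
  case=> l [y sy Dy]; exists l, (f ^+ k * y); first by exists k, y.
  by rewrite mulrCA -Dy mulrC mulfVK.
have zENp : ~ is_nz_pth_power p (zeta%:A : E).
  by case=> z z0 Dz; apply: zfN; rewrite Dz; apply: pspan_pow.
have fE0 : f%:A != 0 :> E by rewrite (fmorph_eq0 (in_alg E)).
have zE0 : zeta%:A != 0 :> E by rewrite (fmorph_eq0 (in_alg E)).
have norm_f := radical_norm_sym p_pr zE_prim fE0 zE0 fENp zfN norm_z.
(* The roles of [f] and [zeta] are now exchanged, which puts [f] in the span of [zeta] and [a]. As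
   [f] is not in the span of [a], exchange contradicts [zN]. *)
have s_zaz := radical_norm_base_span zeta0 zENp f0 norm_f.
have s_za : pspan p [:: zeta; a] f.
  apply: pspan_sub s_zaz => c; rewrite !inE => sc; apply: pspan_mem.
  by rewrite !inE orbA orbC in sc *; case/or3P: sc => ->; rewrite ?orbT.
have [|//|s_fa] := pspan_exchange p_pr _ s_za.
  by rewrite !inE !negb_or ![0 == _]eq_sym zeta0 a0.
apply: zN; apply: pspan_sub s_fa => c; rewrite !inE => sc; apply: pspan_mem.
by rewrite !inE orbC.
Qed.

Lemma rigid_radical_norm_span (b n : E) :
  b != 0 -> ~ is_nz_pth_power p b -> n != 0 -> radical_norm p (zeta%:A : E) b n ->
  pspan p [:: b] n.
Proof.
move=> b0 bNp n0 norm_n.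
have zE_prim : p.-primitive_root (zeta%:A : E) by rewrite (fmorph_primitive_root (in_alg E)).
have alpha0 : alpha != 0.
  apply: contraNneq a0 => alpha0.
  by rewrite -(fmorph_eq0 (in_alg E)) /= -Dalpha alpha0 expr0n gtn_eqF.
have [r kr] := radical_kummer p_pr zeta_prim a0 aNp Dalpha genE.
have decomp (x : E) : x != 0 -> exists k g e,
    [/\ g != 0, e != 0 & x = alpha ^+ k * g%:A * e ^+ p].
  move=> x0.
  have [k [g [e [g0 e0 _ Dx]]]] :=
    kummer_decomposition p_pr p_odd zeta_prim a0 kr aNp rigF (erefl x) x0.
  by exists k, g, e.
have alphaX j : alpha ^+ (j * p) = (a ^+ j)%:A.
  by rewrite mulnC exprM Dalpha exprZn expr1n.
have in_algM (u v : F) : (u * v)%:A = u%:A * v%:A :> E by apply: (rmorphM (in_alg E)).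
have base_case (f g : F) (e w : E) : f != 0 -> g != 0 -> e != 0 -> w != 0 ->
    b = f%:A * e ^+ p -> n = g%:A * w ^+ p -> pspan p [:: b] n.
  move=> f0 g0 e0 w0 Db Dn.
  have fENp : ~ is_nz_pth_power p (f%:A : E).
    case=> z z0 Dz; apply: bNp; exists (z * e); first by rewrite mulf_neq0.
    by rewrite Db Dz exprMn.
  have norm_g : radical_norm p (zeta%:A : E) f%:A g%:A.
    have -> : g%:A = n * w^-1 ^+ p by rewrite Dn exprVn mulfK // expf_neq0.
    apply: radical_normM (radical_norm_pow _ _ _ _).
    apply: (radical_norm_scale p_pr (e := e)) => //; last by rewrite -Db.
    by rewrite (fmorph_eq0 (in_alg E)).
  rewrite Dn; apply: pspanM; last exact: pspan_pow.
  apply: pspan_sub (base_norm_span f0 fENp g0 norm_g) => c; rewrite inE => /eqP->.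
  have -> : f%:A = b * e^-1 ^+ p by rewrite Db exprVn mulfK // expf_neq0.
  apply: pspanM; first exact: pspan_mem (mem_head _ _).
  by apply: pspan_pow; rewrite invr_eq0.
have [k [f [e [f0 e0 Db]]]] := decomp b b0.
have [l [g [w [g0 w0 Dn]]]] := decomp n n0.
(* If [p] divides [k], then [alpha^k] lies in [F]. The exponent [l] is then a multiple of [p] too,
   as otherwise [a] would lie in the span of the element of [F] representing [b]. *)
case: (boolP (p %| k)%N) => [/dvdnP[k' Dk]|pk].
  have Db' : b = (a ^+ k' * f)%:A * e ^+ p.
    by rewrite Db Dk alphaX -in_algM.
  have f'0 : a ^+ k' * f != 0 by rewrite mulf_neq0 ?expf_neq0.
  have norm_f' : radical_norm p (zeta%:A : E) (a ^+ k' * f)%:A n.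
    apply: (radical_norm_scale p_pr (e := e)) => //; last by rewrite -Db'.
      by rewrite (fmorph_eq0 (in_alg E)).
    case=> z z0 Dz; apply: bNp; exists (z * e); first by rewrite mulf_neq0.
    by rewrite Db' Dz exprMn.
  have fENp : ~ is_nz_pth_power p ((a ^+ k' * f)%:A : E).
    case=> z z0 Dz; apply: bNp; exists (z * e); first by rewrite mulf_neq0.
    by rewrite Db' Dz exprMn.
  have [_ aNf] := fNp_ext f'0 fENp.
  have /dvdnP[l' Dl] : (p %| l)%N.
    apply/negP => /negP pl; apply: aNf; apply: (pspan_root p_pr a0 pl).
    exact: radical_norm_exponent f'0 fENp g0 w0 Dn norm_f'.
  apply: (base_case _ (a ^+ l' * g) e w f'0 _ e0 w0 Db').
    by rewrite mulf_neq0 ?expf_neq0.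
  by rewrite Dn Dl alphaX -in_algM.
have [u [v uv]] := bezout_prime p_pr pk.
(* As [u k = v p + 1], this [j] makes [l + k j] a multiple of [p], so that [n b^j] comes from [F]
   modulo pth powers. *)
pose j := (u * p.-1 * l)%N.
have [l' Dl] : exists l', (l + k * j = l' * p)%N.
  exists (v * p.-1 * l + l)%N.
  have -> : (k * j = u * k * (p.-1 * l))%N by rewrite /j; ring.
  by rewrite uv -(prednK p_gt0) /=; ring.
pose m := g * f ^+ j; pose x := w * e ^+ j; have m0 : m != 0 by rewrite mulf_neq0 ?expf_neq0.
have x0 : x != 0 by rewrite mulf_neq0 ?expf_neq0.
have Dm : n * b ^+ j = (a ^+ l' * m)%:A * x ^+ p.
  have -> : (a ^+ l' * m)%:A = alpha ^+ l * (alpha ^+ k) ^+ j * (g%:A * f%:A ^+ j).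
    by rewrite !in_algM -alphaX -Dl exprD exprM exprZn expr1n.
  by rewrite Dn Db !exprMn [e ^+ j ^+ p]exprAC; ring.
have m'0 : a ^+ l' * m != 0 by rewrite mulf_neq0 ?expf_neq0.
set m' := a ^+ l' * m in Dm m'0.
have Dm' : m'%:A = n * b ^+ j * x^-1 ^+ p by rewrite Dm exprVn mulfK // expf_neq0.
have norm_b : radical_norm p (zeta%:A : E) b b by apply: radical_norm_root_self.
have norm_m : radical_norm p (zeta%:A : E) b m'%:A.
  rewrite Dm'; apply: radical_normM (radical_norm_pow _ _ _ _); apply: radical_normM => //.
  apply: (@radical_norm_span _ _ _ _ [:: b]) => [c|]; first by rewrite inE => /eqP->.
  exact/pspanX/pspan_mem/mem_head.
suff sm : pspan p [:: b] m'%:A.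
  apply: (@pspanMl _ _ p_pr _ (b ^+ j)); first by rewrite expf_neq0.
    exact/pspanX/pspan_mem/mem_head.
  by rewrite mulrC Dm; apply: pspanM sm _; apply: pspan_pow.
(* Otherwise, by symmetry, [b] is a norm from the extension by a pth root of [m']. Then [a^k], and
   hence [a], lies in the span of [m'], although [m'] is not a pth power in [E]. *)
apply: NNPP => smN; have mE0 : m'%:A != 0 :> E by rewrite (fmorph_eq0 (in_alg E)).
have mENp : ~ is_nz_pth_power p (m'%:A : E).
  by case=> z z0 Dz; apply: smN; rewrite Dz; apply: pspan_pow.
have norm_b' := radical_norm_sym p_pr zE_prim b0 mE0 bNp smN norm_m.
have [_ aNm] := fNp_ext m'0 mENp; apply: aNm; apply: (pspan_root p_pr a0 pk).
exact: radical_norm_exponent m'0 mENp f0 e0 Db norm_b'.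
Qed.

End RigidExtension.

Theorem theorem3p16 (p : nat) (F : fieldType) (zeta : F) (a : F)
    (E : fieldExtType F) (alpha : E) :
  prime p -> odd p ->
  p.-primitive_root zeta ->
  a != 0 -> ~ is_nz_pth_power p a ->
  alpha ^+ p = a%:A -> <<1; alpha>>%VS = fullv ->
  p_rigid F p -> p_rigid E p.
Proof.
move=> p_pr p_odd zeta_prim a0 aNp Dalpha genE rigF b b0 bNp K beta Dbeta genK y y0.
have p_gt0 := prime_gt0 p_pr.
have zE_prim : p.-primitive_root (zeta%:A : E) by rewrite (fmorph_primitive_root (in_alg E)).
have [r kr] := radical_kummer p_pr zE_prim b0 bNp Dbeta genK.
have Ny : cyc_norm p r y = in_alg K (fieldNorm y).
  have /eqP-> := xchooseP (radical_poly genK y); set q := xchoose _.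
  rewrite [RHS](fieldNorm_radical p_pr b0 bNp Dbeta genK zE_prim).
  by apply: eq_bigr => i _; rewrite (iter_kummer_horner kr) -rmorphXn.
have n0 : fieldNorm y != 0 by have := cyc_norm_neq0 p r y0; rewrite Ny fmorph_eq0.
have norm_y := kummer_radical_norm p_pr zE_prim b0 kr bNp (erefl y) Ny.
have [k [_ [z z0 ->] Dn]] :=
  rigid_radical_norm_span p_pr p_odd zeta_prim a0 aNp Dalpha genE rigF b0 bNp n0 norm_y.
(* Rigidity asks for an exponent below [p]; the remaining power of [b] is a pth power. *)
exists (k %% p)%N; first by rewrite ltn_pmod.
exists ((b ^+ (k %/ p) * z) ^+ p).
  by exists (b ^+ (k %/ p) * z); rewrite // mulf_neq0 ?expf_neq0.
by rewrite Dn {1}(divn_eq k p) addnC exprD exprM exprMn mulrA.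
Qed.
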